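(* There is a surface $\Gamma$ of genus $13$ which carries a tiling by $24$ hyperbolic pentagons of type $\{5,10\}$. This surface is a $2$-cover of the Bring surface $B$ branched over the $12$ vertices of the $\{5,5\}$ tessellation of $B$. The von Dyck group $\Delta^+_{13}(2,5,10)$ exists and has order $120$.
   Context: Surfaces are closed, connected and orientable. A tiling (tessellation) of type $\{p,q\}$ on a surface is a tiling by (possibly curved) regular $p$-gons, two of which are disjoint, meet at a common vertex or meet along a common side, with exactly $q$ polygons meeting at each vertex. The Bring surface $B$ is the Riemann surface of genus $4$ underlying Bring's curve (the curve $\sum_{i=1}^5 x_i=\sum_{i=1}^5 x_i^2=\sum_{i=1}^5 x_i^3=0$ in $\mathbb{P}^4(\mathbb{C})$). It is a triple branched cover of the sphere with icosahedral tessellation, and it carries a regular tessellation of type $\{5,5\}$ by $12$ hyperbolic pentagons, with $12$ vertices and $30$ edges, whose face centers map to the $12$ vertices of the icosahedral tessellation and whose $12$ vertices are branch points (of branch index $2$) lying over the same $12$ points. For a surface $S_g$ of genus $g$ with a regular tiling by $5$-gons meeting ten at each vertex, the triangle group $\Delta_g(2,5,10)$ is the group generated by the three reflections in the sides of a right triangle of the barycentric subdivision of the tiling, with angles $\pi/2,\pi/5,\pi/10$, subject to the resulting relations together with those imposed by the surface $S_g$. The von Dyck group $\Delta^+_g(2,5,10)$ is its index-$2$ subgroup of rotations; it is generated by a half-turn $\mathcal{R}$ about the midpoint of an edge and a rotation $\mathcal{S}$ of order $5$ about the center of a face, with relations $\mathcal{R}^2=\mathcal{S}^5=(\mathcal{S}^{-1}\mathcal{R})^{10}=\mathrm{Id}$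 plus relations depending on $S_g$ ($\mathcal{S}^{-1}\mathcal{R}$ being a rotation about a vertex). That it ''exists'' for $g=13$ means that it is realized as such a rotation group of a regular tiling of type $\{5,10\}$ on a surface of genus $13$. *)

(* Defs.v *)
From HB Require Import structures.
From Stdlib Require Import Relations.
From mathcomp Require Import all_boot all_order all_algebra all_fingroup.
From mathcomp Require Import complex.
From mathcomp Require Import all_classical all_reals all_analysis.

Set Implicit Arguments.
Unset Strict Implicit.
Unset Printing Implicit Defensive.

Import Order.TTheory GRing.Theory Num.Theory.
Import numFieldNormedType.Exports.

Local Open Scope classical_set_scope.
Local Open Scope quotient_scope.
Local Open Scope ring_scope.

(* In the Klein model of the hyperbolic plane geodesics are straight segments,
   so a regular p-gon centred at the origin is a Euclidean regular p-gon.
   Interior angle 2 pi / q forces cosh r = cot (pi / p) * cot (pi / q) for the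
   hyperbolic circumradius r, and the Euclidean circumradius is tanh r. *)
Section HyperbolicPolygon.
Context (R : realType).
Variables p q : nat.

Definition circumradius : R :=
  Num.sqrt (1 - (tan (pi / p%:R) * tan (pi / q%:R)) ^+ 2).

Definition corner (k : nat) : R * R :=
  (circumradius * cos (2 * pi * k%:R / p%:R),
   circumradius * sin (2 * pi * k%:R / p%:R)).

(* Height of z in the direction of the outer normal of the side joining
   corner k to corner k.+1. *)
Definition height (k : nat) (z : R * R) : R :=
  z.1 * cos (pi * (2 * k + 1)%:R / p%:R) +
  z.2 * sin (pi * (2 * k + 1)%:R / p%:R).

Definition apothem : R := circumradius * cos (pi / p%:R).

Definition polygon : set (R * R) :=
  [set z | forall k : nat, (k < p)%N -> height k z <= apothem].

Definition base_side : set (R * R) :=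
  [set z | polygon z /\ height 0 z = apothem].

Definition turn (z : R * R) : R * R :=
  (cos (2 * pi / p%:R) * z.1 - sin (2 * pi / p%:R) * z.2,
   sin (2 * pi / p%:R) * z.1 + cos (2 * pi / p%:R) * z.2).

(* A dart is a side of a tile.  The copy of the polygon indexed by d is the tile
   of d, placed so that d is the side from corner 0 to corner 1.  Hence the
   copies indexed by the p sides of one tile differ by rotations, and a side is
   glued to its partner by the isometry exchanging the two ends (which is affine
   in the Klein model, the hyperbolic and the Euclidean midpoints of a side
   being the same by symmetry). *)
Variables (D : finType) (face edge : {perm D}).

Inductive glue_step : D * (R * R) -> D * (R * R) -> Prop :=
| Turn_step d z : polygon z -> glue_step (face d, z) (d, turn z)
| Cross_step d z : base_side z ->
    glue_step (d, z) (edge d, corner 0 + corner 1 - z).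

Definition glued := clos_refl_sym_trans _ glue_step.

End HyperbolicPolygon.

(* A tiling of type {p,q} of a closed, connected, orientable surface X by
   hyperbolic regular p-gons.  The permutation tface sends a side of a tile to
   the next one, counterclockwise, and tedge sends it to the same edge seen from
   the tile across it; tedge * tface (tedge first) turns around the starting
   corner of a side.  Since finitely many polygons are compact and X is
   Hausdorff, tchart_surj and tchart_glue make X homeomorphic to the space
   obtained from the polygons by gluing sides in pairs, compatibly with their
   orientations: X is a closed orientable surface, and ttrans says that it is
   connected. *)
Record tiling (R : realType) (p q : nat) (X : topologicalType) := Tiling {
  tdart : finType;
  tface : {perm tdart};
  tedge : {perm tdart};
  tchart : tdart -> R * R -> X;
  thyperbolic : (4 < (p - 2) * (q - 2))%N;
  tedgeK : forall d, tedge (tedge d) = d;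
  tedge_neq : forall d, tedge d != d;
  ttrans : [transitive <<[set tface; tedge]%SET>>, on [set: tdart]%SET | 'P];
  tface_deg : forall d, #|porbit tface d| = p;
  tnode_deg : forall d, #|porbit (tedge * tface)%g d| = q;
  (* the corners of a tile are distinct points of X *)
  tcorner_inj : forall d e,
    e \in porbit tface d -> e \in porbit (tedge * tface)%g d -> e = d;
  (* two tiles with a common side d have no other common point: a common corner
     is one of the two ends of d *)
  tside_meet : forall d x y,
    tedge d \notin porbit tface d ->
    x \in porbit tface d -> y \in porbit tface (tedge d) ->
    y \in porbit (tedge * tface)%g x ->
    x \in porbit (tedge * tface)%g d \/
    x \in porbit (tedge * tface)%g (tface d);
  thausdorff : hausdorff_space X;
  tchart_cont : forall d, {within polygon p q, continuous (tchart d)};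
  tchart_surj : forall x, exists d, exists2 z, polygon p q z & tchart d z = x;
  tchart_glue : forall d e z w, polygon p q z -> polygon p q w ->
    (tchart d z = tchart e w <-> glued p q tface tedge (d, z) (e, w))
}.

Section Tiling.
Context (R : realType) (p q : nat) (X : topologicalType).
Variable t : tiling R p q X.

Definition tnode : {perm tdart t} := (tedge t * tface t)%g.

Definition num_tiles := #|porbits (tface t)|.
Definition num_edges := #|porbits (tedge t)|.
Definition num_vertices := #|porbits tnode|.

Definition has_genus (g : nat) :=
  num_vertices%:Z - num_edges%:Z + num_tiles%:Z = 2 - 2 * g%:Z.

Definition vertices : set X := range (fun d : tdart t => tchart d (corner R p q 0)).

(* Symmetries of the tiling act on the darts; an orientation-reversing one
   exchanges "next side" and "previous side". *)
Definition rotations : {set {perm tdart t}} := 'C([set tface t; tedge t]%SET)%g.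

Definition reversing (h : {perm tdart t}) :=
  (tface t ^ h = (tface t)^-1)%g /\ (tedge t ^ h = tedge t)%g.

(* The triangle of the barycentric subdivision based at d has for vertices the
   centre of the tile of d, the midpoint of d and the starting corner of d.
   The reflections in its sides, listed by their axes: centre-midpoint,
   centre-corner, midpoint-corner. *)
Definition triangle_reflections (d : tdart t) (cm cv mv : {perm tdart t}) :=
  [/\ reversing cm /\ cm d = d,
      reversing cv /\ cv d = ((tface t)^-1)%g d &
      reversing mv /\ mv d = tedge t d].

Definition regular :=
  forall d, exists cm cv mv, triangle_reflections d cm cv mv.

Definition triangle_group (cm cv mv : {perm tdart t}) : {set {perm tdart t}} :=
  <<[set cm; cv; mv]%SET>>%g.

Definition von_dyck (cm cv mv : {perm tdart t}) : {set {perm tdart t}} :=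
  (triangle_group cm cv mv :&: rotations)%g.

Definition half_turn (d : tdart t) (r : {perm tdart t}) :=
  r \in rotations /\ r d = tedge t d.

Definition face_rotation (d : tdart t) (s : {perm tdart t}) :=
  s \in rotations /\ s d = tface t d.

End Tiling.

(* The covering degree is 2 off V.  For surfaces and V finite, a single
   preimage of y in V means that the branch index there is 2. *)
Definition double_cover_branched_over (X Y : topologicalType) (f : X -> Y)
    (V : set Y) :=
  [/\ continuous f,
      forall y, V y -> exists! x, f x = y &
      forall y, ~ V y -> exists U U1 U2,
        [/\ open U /\ U y, open U1 /\ open U2,
            U1 `&` U2 = set0 /\ f @^-1` U = U1 `|` U2,
            set_bij U1 U f /\ set_bij U2 U f &
            forall W, open W -> W `<=` U1 `|` U2 -> open (f @` W)]].

Section Bring.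
Variable R : realType.

(* Declared as a numFieldType to give R[i] the topology of its norm. *)
Definition complexes : numFieldType := R[i].

Definition bring_cone : set 'rV[complexes]_5 :=
  [set x | [/\ x != 0, \sum_i x 0 i = 0, \sum_i x 0 i ^+ 2 = 0
             & \sum_i x 0 i ^+ 3 = 0]].

Definition same_point (x y : bring_cone) : bool :=
  `[< exists c : complexes, c != 0 /\ \val y = c *: \val x >].

Lemma same_point_equiv : equiv_class_of same_point.
Proof.
split.
- by move=> x; apply/asboolP; exists 1; rewrite oner_neq0 scale1r.
- have sym x y : same_point x y -> same_point y x.
    move=> /asboolP[c [c0 e]]; apply/asboolP; exists c^-1.
    by rewrite invr_eq0 c0 e scalerA mulVf // scale1r.
  by move=> x y; apply/idP/idP; exact: sym.
- move=> y x z /asboolP[c [c0 e]] /asboolP[c' [c'0 e']]; apply/asboolP.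
  by exists (c' * c); rewrite mulf_neq0 // e' e scalerA.
Qed.

Canonical same_point_equiv_rel := EquivRelPack same_point_equiv.

(* Bring's curve in the projective space of lines of C^5, with the topology of
   its complex points. *)
Definition bring_surface : topologicalType :=
  quotient_topology {eq_quot same_point_equiv_rel}.

Definition bring_tessellation (T : tiling R 5 5 bring_surface) :=
  [/\ regular T, num_tiles T = 12%N, num_vertices T = 12%N
    & num_edges T = 30%N].

End Bring.

(* Main.v *)
Require Import Defs.
From HB Require Import structures.
From Stdlib Require Import Relations.
From mathcomp Require Import all_boot all_order all_algebra all_fingroup.
From mathcomp Require Import cyclic pgroup sylow.
From mathcomp Require Import all_classical all_reals all_analysis.
From mathcomp Require Import ring lra.

Set Implicit Arguments.
Unset Strict Implicit.
Unset Printing Implicit Defensive.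

Import Order.TTheory GRing.Theory Num.Theory.
Import numFieldNormedType.Exports.

(** The map of the great dodecahedron, the regular map of type {5,5} with twelve
    pentagons, has the sixty elements of PSL(2,5) as darts: with s : x -> x + 1 and
    r : x -> 1 / x on the projective line over the field with five elements, the
    next side of the tile of g is gs, and the same edge seen from the other tile is
    gr. Take two copies of every pentagon and let each crossing of an edge change
    the sheet. A turn around a vertex crosses five edges, hence exchanges the sheets,
    so each vertex has a single vertex above it, of degree ten. This gives a map of
    type {5,10} with 24 tiles, 60 edges and 12 vertices, whose genus is 13, and whose
    rotations are the 120 elements of PSL(2,5) x Z/2 ([gamma_tiling]). Gluing regular
    pentagons along it gives a compact surface. It is Hausdorff because its points
    are separated by continuous functions, sums over the sides of a tile of products
    of distances to the five sides ([separate], [surface_hausdorff]).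

    Every regular tiling of type {5,5} with twelve tiles has the same combinatorics
    ([ico_unique]). Its monodromy group has order 60 and six Sylow 5-subgroups: if
    there were one only, it would contain the turns around a tile and around a vertex,
    and with them the half-turn that is their quotient. The six subgroups are
    labelled by the projective line so that the turn around a tile acts as x + 1.
    An element fixing two of them has trivial square, and this leaves 1 / x as the
    only possible action of the half-turn. The group thus maps onto PSL(2,5), which
    has the same order.

    In the Klein model the pentagons of types {5,10} and {5,5} are homothetic.
    Rescaling each tile of the surface to the tile below it therefore defines a
    continuous map to any surface tiled as above, in particular to the Bring
    surface. Its fibres are the orbits of the exchange of the sheets, whose fixed
    points are the vertices, and this makes it a double cover branched over the
    vertices ([involution_double_cover], [covering_branched]).

    Finally, a rotation is determined by the image of one dart. Products of two of
    the reflections in the sides of a triangle are rotations that send its dart to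
    the next side and across its edge; they generate a transitive group, which is
    therefore the group of all rotations, with as many elements as there are darts
    ([von_dyck_group]). *)

(** * Rotations and reflections of a map *)

Section PermutationOrbits.
Variables (D : finType) (f : {perm D}).
Local Open Scope group_scope.

Lemma card_porbit_free n d : (0 < n)%N -> iter n f d = d ->
  (forall k, (k < n)%N -> iter k f d = d -> k = 0%N) -> #|porbit f d| = n.
Proof.
move=> n0 fn free; have m0 : (0 < #|porbit f d|)%N.
  by apply/card_gt0P; exists d; exact: porbit_id.
case: (ltngtP #|porbit f d| n) => // [lt|lt].
  by have := free _ lt (iter_porbit f d) => e; rewrite e in m0.
have u := uniq_traject_porbit f d.
have := nth_uniq d (_ : 0 < size (traject f d #|porbit f d|)) (_ : n < _) u.
rewrite size_traject => /(_ m0 lt); rewrite !nth_traject // fn eqxx.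
by case: n n0 {fn free lt} => // n _.
Qed.

Lemma iter_fixed_dvd n d : (iter n f d == d) = (#|porbit f d| %| n)%N.
Proof.
set m := #|porbit f d|; have m0 : (0 < m)%N.
  by apply/card_gt0P; exists d; exact: porbit_id.
have -> : iter n f d = iter (n %% m) f d.
  rewrite {1}(divn_eq n m) addnC iterD; congr iter.
  by elim: (n %/ m)%N => // k IH; rewrite mulSn iterD IH iter_porbit.
rewrite /dvdn; have := nth_uniq d (_ : n %% m < size (traject f d m)) (_ : 0 < _)
  (uniq_traject_porbit f d).
by rewrite size_traject ltn_mod => /(_ m0 m0); rewrite !nth_traject ?ltn_mod.
Qed.

Lemma card_porbits n : (forall d, #|porbit f d| = n) -> (#|porbits f| * n = #|D|)%N.
Proof.
move=> fn; have part : finset.partition (porbits f) [set: D].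
  apply/and3P; split.
  - apply/eqP/setP => d; rewrite inE; apply/finset.bigcupP.
    by exists (porbit f d); [exact: imset_f | exact: porbit_id].
  - apply/finset.trivIsetP => _ _ /imsetP[d _ ->] /imsetP[e _ ->] ne.
    rewrite -finset.setI_eq0; apply: contraNT ne => /finset.set0Pn[x /setIP[xd xe]].
    by apply/eqP; rewrite -!eq_porbit_mem in xd xe; rewrite -(eqP xd) (eqP xe).
  - apply/imsetP => -[d _ /setP/(_ d)]; rewrite inE porbit_id; done.
rewrite -cardsT; apply/esym; apply: card_uniform_partition part => _ /imsetP[d _ ->]; exact: fn.
Qed.
End PermutationOrbits.

Section Maps.
Local Open Scope group_scope.
Variables (D : finType) (face edge : {perm D}).
Hypothesis conn : [transitive <<[set face; edge]>>, on [set: D] | 'P].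

(** Connectedness as an induction principle: a set stable under [face] and
    [edge] is stable under the transitive group that they generate. *)
Lemma dart_ind (P : pred D) d0 : P d0 -> (forall d, P d -> P (face d)) ->
  (forall d, P d -> P (edge d)) -> forall d, P d.
Proof.
move=> P0 Pf Pe d.
have sub : <<[set face; edge]>> \subset 'N([set x | P x] | 'P).
  rewrite gen_subG; apply/fintype.subsetP => g /set2P gE.
  rewrite /astabs inE finset.in_setT /= inE; apply/fintype.subsetP => x; rewrite !inE /= apermE.
  by case: gE => ->; [exact: Pf | exact: Pe].
have : d \in orbit 'P <<[set face; edge]>> d0 by rewrite (atransP conn) ?inE.
case/orbitP => g /(fintype.subsetP sub) /astabsP /(_ d0) + <-.
by rewrite !inE P0.
Qed.

Lemma rotationP (h : {perm D}) : reflect ((forall x, h (face x) = face (h x)) /\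
    (forall x, h (edge x) = edge (h x))) (h \in 'C([set face; edge])).
Proof.
apply: (iffP centP) => [c|[cf ce] g /set2P[]->].
- split=> x; first by have := c face (set21 _ _); rewrite /commute => /permP/(_ x); rewrite !permM.
  by have := c edge (set22 _ _); rewrite /commute => /permP/(_ x); rewrite !permM.
- by apply/permP => x; rewrite !permM.
- by apply/permP => x; rewrite !permM.
Qed.

(** A form without inverses, convenient for building reversing maps. *)
Lemma reversalP (h : {perm D}) : (face ^ h = face^-1 /\ edge ^ h = edge) <->
  ((forall x, face (h (face x)) = h x) /\ (forall x, h (edge x) = edge (h x))).
Proof.
split=> [[hf he]|[hf he]].
  split=> x; first by rewrite -[h (face x)]permM conjgC hf !permM permKV.
  by rewrite -permM conjgC he permM.
split; apply/permP => x; rewrite -[x](permKV h); move: (h^-1 x) => y.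
  by rewrite !permM permK -[h (face y)](permK face) hf.
by rewrite !permM permK he.
Qed.

(** The fixed points of a rotation are stable under [face] and [edge], so one
    fixed dart forces all of them. *)
Lemma rotation_fixed (h : {perm D}) d : h \in 'C([set face; edge]) -> h d = d -> h = 1.
Proof.
case/rotationP => hf he hd; apply/permP => e; rewrite perm1; apply/eqP; move: e.
apply: (dart_ind (d0 := d)) => [|e /eqP|e /eqP] /=; first exact/eqP.
  by rewrite hf => ->.
by rewrite he => ->.
Qed.

Lemma rotation_inj (g h : {perm D}) d : g \in 'C([set face; edge]) -> h \in 'C([set face; edge]) ->
  g d = h d -> g = h.
Proof.
move=> gR hR gh; apply/eqP; rewrite eq_mulgV1; apply/eqP.
by apply: (@rotation_fixed _ d); [rewrite groupM ?groupV | rewrite permM gh permK].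
Qed.

(** [u] and [h] commute and agree at [d], so the powers of [h] move [d] as those
    of [u] do; and a power of [h] that fixes [d] is trivial. *)
Lemma rotation_order (h u : {perm D}) d : h \in 'C([set face; edge]) ->
  (forall x, h (u x) = u (h x)) -> h d = u d -> #[h] = #|porbit u d|.
Proof.
move=> hR hu hd.
have it n : (h ^+ n) d = iter n u d.
  elim: n => [|n IH]; first by rewrite expg0 perm1.
  rewrite expgS permM hd iterS -IH.
  by elim: n {IH} => [|n IH]; rewrite ?expg0 ?perm1 // expgSr !permM IH hu.
suff dv n : (#[h] %| n) = (#|porbit u d| %| n)%N.
  by apply/eqP; rewrite eqn_dvd; apply/andP; split; [rewrite dv | rewrite -dv].
rewrite order_dvdn -iter_fixed_dvd -it; apply/eqP/eqP => [->|hn]; first by rewrite perm1.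
by apply: (rotation_fixed (d := d)); rewrite ?groupX.
Qed.

Section Rotations.
Variables (A : {group {perm D}}) (d : D) (r s : {perm D}).
Hypotheses (sA : s \in A) (rA : r \in A) (AR : A \subset 'C([set face; edge])).
Hypotheses (sd : s d = face d) (rd : r d = edge d).

(** If [h] sends [d] to [e], then [s] followed by [h] sends [d] to [face e],
    because [h] commutes with [face]; likewise for [r] and [edge]. *)
Lemma rotations_transitive e : exists2 h, h \in A & h d = e.
Proof.
suff /exists_inP[h hA /eqP] : [exists (h | h \in A), h d == e] by exists h.
move: e; apply: (dart_ind (d0 := d)) => [|e|e].
- by apply/exists_inP; exists 1; rewrite ?group1 ?perm1.
- case/exists_inP => h hA /eqP <-; apply/exists_inP; exists (s * h); first exact: groupM.
  by have /rotationP[hf _] := fintype.subsetP AR _ hA; rewrite permM sd hf.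
- case/exists_inP => h hA /eqP <-; apply/exists_inP; exists (r * h); first exact: groupM.
  by have /rotationP[_ he] := fintype.subsetP AR _ hA; rewrite permM rd he.
Qed.

Lemma rotations_all : A = 'C([set face; edge]) :> {set _}.
Proof.
apply/eqP; rewrite finset.eqEsubset AR; apply/fintype.subsetP => g gR.
have [h hA hd] := rotations_transitive (g d).
by rewrite (@rotation_inj g h d) // (fintype.subsetP AR).
Qed.

Lemma card_rotations : #|A| = #|D|.
Proof.
rewrite -cardsT; have -> : [set: D] = [set h d | h : {perm D} in A].
  apply/setP => e; rewrite inE; apply/esym/imsetP.
  by have [h hA <-] := rotations_transitive e; exists h.
rewrite card_in_imset // => g h gA hA; apply: rotation_inj; exact: (fintype.subsetP AR).
Qed.
End Rotations.

Section Reflections.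
Variables (d : D) (cm cv mv : {perm D}).
Hypotheses (cmR : face ^ cm = face^-1 /\ edge ^ cm = edge)
           (cvR : face ^ cv = face^-1 /\ edge ^ cv = edge)
           (mvR : face ^ mv = face^-1 /\ edge ^ mv = edge).
Hypotheses (cmd : cm d = d) (cvd : cv d = face^-1 d) (mvd : mv d = edge d).

Definition reversals := [set h | (face ^ h == face^-1) && (edge ^ h == edge)].

Lemma reversalsM g h : g \in reversals -> h \in reversals -> g * h \in 'C([set face; edge]).
Proof.
rewrite !inE => /andP[/eqP gf /eqP ge] /andP[/eqP hf /eqP he].
apply/centP => x /set2P[]->; apply: commute_sym; apply/commgP/conjg_fixP; rewrite conjgM.
  by rewrite gf conjVg hf invgK.
by rewrite ge.
Qed.

(** Two reflections compose to a rotation about the common end of their axes: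
    the centre of the tile for [cm] and [cv], the midpoint of the side for [cm]
    and [mv]. *)
Definition turn_face := (cm * cv)^-1.
Definition turn_edge := cm * mv.

Lemma inRev (h : {perm D}) : face ^ h = face^-1 /\ edge ^ h = edge -> h \in reversals.
Proof. by case=> hf he; rewrite inE hf he !eqxx. Qed.

Lemma turn_faceP : turn_face \in 'C([set face; edge]) /\ turn_face d = face d.
Proof.
have R : turn_face \in 'C([set face; edge]) by rewrite groupV reversalsM ?inRev.
split=> //; have /rotationP[hf _] := R.
rewrite -{1}[d](permKV face) hf; congr (face _).
by rewrite -cvd; apply: (@perm_inj _ (cm * cv)); rewrite permKV permM cmd.
Qed.

Lemma turn_edgeP : turn_edge \in 'C([set face; edge]) /\ turn_edge d = edge d.
Proof. by split; [rewrite reversalsM ?inRev | rewrite permM cmd]. Qed.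

Lemma rotations_gen : <<[set turn_edge; turn_face]>> = 'C([set face; edge]).
Proof.
have [fR fd] := turn_faceP; have [eR ed] := turn_edgeP.
apply: (rotations_all (d := d) (s := turn_face) (r := turn_edge)) => //.
- by rewrite mem_gen ?set22.
- by rewrite mem_gen ?set21.
- by rewrite gen_subG; apply/fintype.subsetP => h /set2P[]->.
Qed.

Lemma card_rotation_group : #|'C([set face; edge])| = #|D|.
Proof.
have [fR fd] := turn_faceP; have [eR ed] := turn_edgeP.
exact: (card_rotations (d := d) (s := turn_face) (r := turn_edge)).
Qed.

Lemma triangle_rotations :
  <<[set cm; cv; mv]>> :&: 'C([set face; edge]) = 'C([set face; edge]).
Proof.
apply/finset.setIidPr; rewrite -rotations_gen gen_subG.
have cmG : cm \in <<[set cm; cv; mv]>> by rewrite mem_gen // !inE eqxx.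
have cvG : cv \in <<[set cm; cv; mv]>> by rewrite mem_gen // !inE eqxx orbT.
have mvG : mv \in <<[set cm; cv; mv]>> by rewrite mem_gen // !inE eqxx orbT.
by apply/fintype.subsetP => h /set2P[]->; rewrite ?groupV groupM.
Qed.

Lemma order_turn_face : #[turn_face] = #|porbit face d|.
Proof.
have [fR fd] := turn_faceP; have /rotationP[hf _] := fR.
exact: rotation_order.
Qed.

Lemma order_turn_edge : #[turn_edge] = #|porbit edge d|.
Proof.
have [eR ed] := turn_edgeP; have /rotationP[_ he] := eR.
exact: rotation_order.
Qed.

Hypothesis edgeK : forall x, edge (edge x) = x.

(** This product moves [d] as [edge * face^-1] does, and [edge] conjugates the
    latter to the inverse of [edge * face], the rotation around a corner. *)
Lemma order_turn_node : #[turn_face^-1 * turn_edge] = #|porbit (edge * face) (edge d)|.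
Proof.
have [fR fd] := turn_faceP; have [eR ed] := turn_edgeP.
have hR : turn_face^-1 * turn_edge \in 'C([set face; edge]).
  by apply: groupM => //; rewrite groupV.
have /rotationP[hf he] := hR.
have hV x : (turn_face^-1 * turn_edge) (face^-1 x) = face^-1 ((turn_face^-1 * turn_edge) x).
  by apply: (@perm_inj _ face); rewrite -hf !permKV.
rewrite (@rotation_order _ (edge * face^-1) d hR).
- suff dv n : (#|porbit (edge * face^-1) d| %| n = (#|porbit (edge * face) (edge d)| %| n))%N.
    by apply/eqP; rewrite eqn_dvd; apply/andP; split; [rewrite dv | rewrite -dv].
  rewrite -(porbitV (edge * face)) -!iter_fixed_dvd.
  have -> : iter n ((edge * face)^-1)%g (edge d) = edge (iter n (edge * face^-1)%g d).
    elim: n => //= n ->; apply: (@perm_inj _ (edge * face)).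
    by rewrite permKV !permM edgeK permKV.
  by rewrite (inj_eq perm_inj).
- move=> x; have -> y : (edge * face^-1) y = face^-1 (edge y) by rewrite permM.
  by rewrite hV he permM.
- have /rotationP[sf _] := fR; have /rotationP[rf _] := eR.
  rewrite (permM turn_face^-1) (permM edge) -ed; apply: (@perm_inj _ face).
  rewrite permKV -rf; congr (turn_edge _).
  by apply: (@perm_inj _ turn_face); rewrite sf permKV fd.
Qed.

Lemma reversal_not_rotation x : face (face x) != x -> cm \notin 'C([set face; edge]).
Proof.
move=> ne; apply/negP => /rotationP[hf _]; have [rf _] := (reversalP _).1 cmR.
by case/eqP: ne; apply: (@perm_inj _ cm); rewrite hf rf.
Qed.

(** The permutations that fix [edge] and send [face] to itself or to its inverse
    under conjugation form a group containing the three reflections, and two of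
    them that both invert [face] differ by a rotation. *)
Lemma index_rotations x : face (face x) != x ->
  #|<<[set cm; cv; mv]>> : 'C([set face; edge])| = 2.
Proof.
move=> ne; have ncm := reversal_not_rotation ne.
pose K := [set h | ((face ^ h == face) || (face ^ h == face^-1)) && (edge ^ h == edge)].
have grp : group_set K.
  apply/group_setP; split; first by rewrite inE !conjg1 !eqxx.
  move=> g h; rewrite !inE !conjgM => /andP[gf /eqP->] /andP[hf ->]; rewrite andbT.
  by case/orP: gf => /eqP->; case/orP: hf => /eqP e; rewrite ?conjVg e ?invgK eqxx ?orbT.
have fixC h : (face ^ h == face) && (edge ^ h == edge) -> h \in 'C([set face; edge]).
  case/andP => hf he; apply/centP => y /set2P[]->; apply: commute_sym; apply/commgP/conjg_fixP;
    exact/eqP.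
have sub h : h \in <<[set cm; cv; mv]>> -> (h \in 'C([set face; edge])) || (h \in reversals).
  have /fintype.subsetP/(_ h) sub : <<[set cm; cv; mv]>> \subset K.
    rewrite (gen_subG _ (Group grp)); apply/fintype.subsetP => g gS.
    have inK f : face ^ f = face^-1 /\ edge ^ f = edge -> f \in K.
      by case=> ff fe; rewrite inE ff fe !eqxx orbT.
    by case/setUP: gS => [/set2P[]|/set1P] ->; apply: inK.
  move=> /sub; rewrite !inE => /andP[/orP[hf|hf] he].
    by rewrite fixC ?hf.
  by rewrite hf he orbT.
rewrite -triangle_rotations; set G := <<_>>; set N := 'C(_).
have cmG : cm \in G by rewrite mem_gen // !inE eqxx.
have -> : #|G : G :&: N| = #|[set (N : {set _}); N :* cm]|.
  rewrite triangle_rotations -/N; congr #|pred_of_set _|.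
  apply/setP => C; rewrite !inE; apply/imsetP/orP => [[h hG ->]|[]/eqP->].
  - have /orP[hN|hB] := sub h hG; [left|right]; rewrite rcosetE.
      by rewrite rcoset_id.
    apply/eqP/rcoset_eqP; rewrite mem_rcoset.
    have -> : h * cm^-1 = (h * cm) * (cm * cm)^-1 by rewrite invMg mulgA mulgK.
    by apply: groupM; rewrite ?groupV; apply: reversalsM => //; exact: inRev.
  - by exists 1; rewrite ?group1 // rcosetE rcoset_id ?group1.
  - by exists cm; rewrite ?rcosetE.
rewrite cards2; have -> // : (N : {set _}) != N :* cm.
by apply: contraNneq ncm => NE; rewrite -/N NE rcoset_refl.
Qed.
End Reflections.
End Maps.

(** * The map of the great dodecahedron *)

(** The numbers 0 to 4 and 5 stand for the projective line over the field with
    five elements, 5 being the point at infinity; [spin], [flip] and [mirror] are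
    the maps x + 1, 1 / x and - x. *)
Definition spin : nat -> nat := nth 0%N [:: 1; 2; 3; 4; 0; 5]%N.
Definition flip : nat -> nat := nth 0%N [:: 5; 1; 3; 2; 4; 0]%N.
Definition mirror : nat -> nat := nth 0%N [:: 0; 4; 3; 2; 1; 5]%N.

Definition grow (l : seq (seq nat)) :=
  undup (l ++ map (map spin) l ++ map (map flip) l).

(** The elements of PSL(2,5), given by their values on the projective line. The
    letters of a word are applied from left to right, and words of at most eleven
    letters give the whole group. *)
Definition psl_table : seq (seq nat) := iter 11 grow [:: iota 0 6].

(** Sealed, as unification would otherwise compute the table. *)
Definition psl := locked psl_table.
Lemma pslE : psl = psl_table. Proof. by rewrite /psl -lock. Qed.

Definition around (w : seq nat) := map spin (map flip w).

(** The product of [u] and of the conjugate of [x] by [mirror]. Conjugation by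
    [mirror] inverts [spin] and fixes [flip], so [mirrored u] is a reversing map of
    the darts. *)
Definition mirrored (u x : seq nat) := [seq mirror (nth 0%N x (mirror y)) | y <- u].

Ltac psl_compute := rewrite pslE; vm_cast_no_check (erefl true).

Lemma psl_size : size psl == 60%N. Proof. by psl_compute. Qed.
Lemma psl_uniq : uniq psl. Proof. by psl_compute. Qed.
Lemma psl_spin : all (fun w => map spin w \in psl) psl. Proof. by psl_compute. Qed.
Lemma psl_flip : all (fun w => map flip w \in psl) psl. Proof. by psl_compute. Qed.
Lemma psl_mirrored : all (fun u => all (fun x => mirrored u x \in psl) psl) psl.
Proof. by psl_compute. Qed.

Lemma psl_spin5 : all (fun w => iter 5 (map spin) w == w) psl. Proof. by psl_compute. Qed.
Lemma psl_spin_free : all (fun w => all (fun k => iter k (map spin) w != w) (iota 1 4)) psl.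
Proof. by psl_compute. Qed.
Lemma psl_flip2 : all (fun w => map flip (map flip w) == w) psl. Proof. by psl_compute. Qed.
Lemma psl_flip_neq : all (fun w => map flip w != w) psl. Proof. by psl_compute. Qed.
Lemma psl_around5 : all (fun w => iter 5 around w == w) psl. Proof. by psl_compute. Qed.
Lemma psl_around_free : all (fun w => all (fun k => iter k around w != w) (iota 1 4)) psl.
Proof. by psl_compute. Qed.

Lemma psl_corner : all (fun w => all (fun i => all (fun j =>
  (iter i (map spin) w == iter j around w) ==> (iter i (map spin) w == w))
  (iota 0 5)) (iota 0 5)) psl.
Proof. by psl_compute. Qed.

Lemma psl_side : all (fun w => all (fun i => all (fun j => all (fun k =>
  (iter k around (iter i (map spin) w) == iter j (map spin) (map flip w)) ==>
  has (fun m => (iter i (map spin) w == iter m around w) ||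
                (iter i (map spin) w == iter m around (map spin w))) (iota 0 5))
  (iota 0 5)) (iota 0 5)) (iota 0 5)) psl.
Proof. by psl_compute. Qed.

Lemma psl_mirror_transitive : all (fun d => all (fun e => has (fun u =>
  mirrored u d == e) psl) psl) psl.
Proof. by psl_compute. Qed.
Lemma psl_mirror_inj : all (fun u => all (fun x => all (fun y =>
  (mirrored u x == mirrored u y) ==> (x == y)) psl) psl) psl.
Proof. by psl_compute. Qed.
Lemma psl_mirror_flip : all (fun u => all (fun x =>
  mirrored u (map flip x) == map flip (mirrored u x)) psl) psl.
Proof. by psl_compute. Qed.
Lemma psl_mirror_spin : all (fun u => all (fun x =>
  map spin (mirrored u (map spin x)) == mirrored u x) psl) psl.
Proof. by psl_compute. Qed.

(** Darts are the elements of PSL(2,5), multiplied on the right by [spin] to reach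
    the next side of the tile and by [flip] to cross the edge; the rotations of
    the map are then the left multiplications. *)
Definition icodart : finType := seq_sub psl.

Lemma ico_inj (w w' : icodart) : ssval w = ssval w' -> w = w'. Proof. exact: val_inj. Qed.

Section Acting.
Variables (F : seq nat -> seq nat) (stable : all (fun w => F w \in psl) psl).
Definition acting (w : icodart) : icodart := SeqSub (allP stable _ (ssvalP w)).
Lemma iter_acting n w : ssval (iter n acting w) = iter n F (ssval w).
Proof. by elim: n => //= n ->. Qed.
End Acting.

Lemma ico_all (P : pred (seq nat)) : all P psl -> forall w : icodart, P (ssval w).
Proof. by move=> /allP h w; exact/h/ssvalP. Qed.

Lemma iota_all (P : pred nat) m n : all P (iota m n) -> forall k, (m <= k < m + n)%N -> P k.
Proof. by move=> /allP h k hk; apply: h; rewrite mem_iota. Qed.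

Lemma mod5_all (P : pred nat) : all P (iota 0 5) -> forall k, P (k %% 5)%N.
Proof. by move=> h k; apply: (iota_all h); rewrite ltn_mod. Qed.

Definition ico_next := acting psl_spin.
Definition ico_opp := acting psl_flip.

Lemma ico_next5 w : iter 5 ico_next w = w.
Proof. by apply: ico_inj; rewrite iter_acting; exact/eqP/(ico_all psl_spin5). Qed.
Lemma ico_oppK : involutive ico_opp.
Proof. by move=> w; apply: ico_inj; exact/eqP/(ico_all psl_flip2). Qed.

Lemma ico_next_inj : injective ico_next.
Proof. by apply: (can_inj (g := iter 4 ico_next)) => w; rewrite -iterSr ico_next5. Qed.
Definition ico_face : {perm icodart} := perm ico_next_inj.
Definition ico_edge : {perm icodart} := perm (can_inj ico_oppK).
Local Notation ico_node := (ico_edge * ico_face)%g.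

Lemma ico_face_val n w : ssval (iter n ico_face w) = iter n (map spin) (ssval w).
Proof. by elim: n => //= n IH; rewrite permE -IH. Qed.
Lemma ico_edge_val w : ssval (ico_edge w) = map flip (ssval w).
Proof. by rewrite permE. Qed.
Lemma ico_node_val n w : ssval (iter n ico_node w) = iter n around (ssval w).
Proof. by elim: n => //= n IH; rewrite permM (ico_face_val 1) ico_edge_val IH. Qed.

Lemma card_ico : #|icodart| = 60%N.
Proof. by rewrite card_seq_sub ?(eqP psl_size) // psl_uniq. Qed.

Lemma ico_edgeK w : ico_edge (ico_edge w) = w.
Proof. by rewrite !permE ico_oppK. Qed.
Lemma ico_edge_neq w : ico_edge w != w.
Proof. by rewrite -val_eqE /= ico_edge_val; exact: (ico_all psl_flip_neq). Qed.
Lemma ico_face5 w : iter 5 ico_face w = w.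
Proof. by apply: ico_inj; rewrite (ico_face_val 5); exact/eqP/(ico_all psl_spin5). Qed.
Lemma ico_node5 w : iter 5 ico_node w = w.
Proof. by apply: ico_inj; rewrite (ico_node_val 5); exact/eqP/(ico_all psl_around5). Qed.
Lemma ico_face_free w k : (k < 5)%N -> iter k ico_face w = w -> k = 0%N.
Proof.
case: k => // k k5 /(congr1 (@ssval _ _)); rewrite ico_face_val => /eqP e.
by have := iota_all (ico_all psl_spin_free w) (k := k.+1) k5; rewrite e.
Qed.
Lemma ico_node_free w k : (k < 5)%N -> iter k ico_node w = w -> k = 0%N.
Proof.
case: k => // k k5 /(congr1 (@ssval _ _)); rewrite ico_node_val => /eqP e.
by have := iota_all (ico_all psl_around_free w) (k := k.+1) k5; rewrite e.
Qed.

Lemma iter_mod5 (T : Type) (f : T -> T) : (forall x, iter 5 f x = x) ->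
  forall n x, iter n f x = iter (n %% 5) f x.
Proof.
move=> f5 n x; rewrite {1}(divn_eq n 5) addnC iterD; congr iter.
by elim: (n %/ 5)%N => // m IH; rewrite mulSn iterD IH f5.
Qed.

(** The cyclic subgroups that turn around a tile and around a vertex meet
    trivially. *)
Lemma ico_corner w i j : iter i ico_face w = iter j ico_node w -> iter i ico_face w = w.
Proof.
rewrite (iter_mod5 ico_face5) (iter_mod5 ico_node5) => /(congr1 (@ssval _ _)) /eqP e.
rewrite ico_face_val ico_node_val in e; apply: ico_inj; rewrite ico_face_val.
exact/eqP/(implyP (mod5_all (mod5_all (ico_all psl_corner w) i) j)).
Qed.

Lemma ico_side w i j k : iter k ico_node (iter i ico_face w) = iter j ico_face (ico_edge w) ->
  exists m, iter i ico_face w = iter m ico_node w \/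
            iter i ico_face w = iter m ico_node (ico_face w).
Proof.
rewrite (iter_mod5 ico_node5 k) (iter_mod5 ico_face5 i) (iter_mod5 ico_face5 j).
move=> /(congr1 (@ssval _ _)) /eqP e.
rewrite ico_node_val !ico_face_val ico_edge_val in e.
have /implyP/(_ e) := mod5_all (mod5_all (mod5_all (ico_all psl_side w) i) j) k.
move=> /hasP[m _ /orP[]/eqP em]; exists m; [left|right]; apply: ico_inj.
  by rewrite /= ico_face_val ico_node_val.
by rewrite /= ico_face_val ico_node_val (ico_face_val 1).
Qed.

(** Every element of the table was reached from the identity by letters [spin]
    and [flip]. *)
Lemma ico_ind (P : icodart -> Prop) (w0 : icodart) : ssval w0 = iota 0 6 ->
  P w0 -> (forall w, P w -> P (ico_face w)) -> (forall w, P w -> P (ico_edge w)) ->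
  forall w, P w.
Proof.
move=> e0 P0 Pf Pe w.
suff h n v : v \in iter n grow [:: iota 0 6] -> exists2 w', ssval w' = v & P w'.
  have sub : {subset psl <= iter 11 grow [:: iota 0 6]} by move=> v; rewrite pslE /psl_table.
  have [w' wE Pw'] := h 11%N _ (sub _ (ssvalP w)).
  by rewrite -(ico_inj wE).
elim: n v => [|n IH] v; first by rewrite inE => /eqP ->; exists w0.
rewrite /= mem_undup !mem_cat.
case/or3P => [/IH//|/mapP[v' /IH[w' <- Pw'] ->]|/mapP[v' /IH[w' <- Pw'] ->]].
  by exists (ico_face w'); [exact: (ico_face_val 1) | exact: Pf].
by exists (ico_edge w'); [exact: ico_edge_val | exact: Pe].
Qed.

Lemma ico_base : exists w0 : icodart, ssval w0 = iota 0 6.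
Proof.
have h : iota 0 6 \in psl by psl_compute.
by exists (SeqSub h).
Qed.

Lemma ico_reflection d e : exists m : {perm icodart}, [/\ m d = e,
  forall x, m (ico_edge x) = ico_edge (m x) & forall x, ico_face (m (ico_face x)) = m x].
Proof.
have /allP/(_ _ (ssvalP e))/hasP[u hu /eqP ue] := ico_all psl_mirror_transitive d.
pose m := acting (allP psl_mirrored u hu).
have inj : injective m.
  move=> x y /(congr1 (@ssval _ _)) /= /eqP xy; apply: ico_inj.
  exact/eqP/(implyP (ico_all (ico_all (allP psl_mirror_inj u hu) x) y)).
have mE x : ssval (perm inj x) = mirrored u (ssval x) by rewrite permE.
exists (perm inj); split=> [|x|x]; apply: ico_inj; rewrite ?mE //.
- by rewrite !ico_edge_val mE; exact/eqP/(ico_all (allP psl_mirror_flip u hu)).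
- by rewrite (ico_face_val 1) mE (ico_face_val 1); exact/eqP/(ico_all (allP psl_mirror_spin u hu)).
Qed.

(** * Uniqueness of the regular map of type {5,5} with sixty darts *)

Section Words.
Local Open Scope group_scope.
Variable flips : seq nat.

(** The letter [true] stands for [edge], acting on the six points through the
    table [flips], and [false] for [face], acting by [spin]. *)
Definition word_act (w : seq bool) (i : nat) : nat :=
  foldl (fun i b => if b then nth 0%N flips i else spin i) i w.

Definition word_fixes_two (w : seq bool) :=
  (1 < count (fun i => word_act w i == i) (iota 0 6))%N.
Definition word_square_trivial (w : seq bool) :=
  all (fun i => word_act (w ++ w) i == i) (iota 0 6).

Definition word_r := [:: true].
Definition word_rs := [:: true; false].

(** The relations of [edge] and [edge * face] allow, besides 1 / x, the two
    involutions that exchange 0 and infinity and one of the pairs {3, 4}, {1, 2}.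
    With [spin] each of these generates a group of order 360, in which [word_1],
    respectively [word_2], fixes two points although its square is not trivial. *)
Definition word_1 := [:: true; false; true; false; false; true; false; false; false].
Definition word_2 := [:: true; false; true; false; false; false; true; false; false].

Definition flips_ok := [&& word_square_trivial word_r,
  all (fun i => word_act (flatten (nseq 5 word_rs)) i == i) (iota 0 6),
  word_fixes_two word_1 ==> word_square_trivial word_1 &
  word_fixes_two word_2 ==> word_square_trivial word_2].
End Words.

Lemma flips_unique a b c d : (a < 6)%N -> (b < 6)%N -> (c < 6)%N -> (d < 6)%N ->
  flips_ok [:: 5; a; b; c; d; 0]%N -> [:: 5; a; b; c; d; 0] = [:: 5; 1; 3; 2; 4; 0]%N.
Proof.
have check : all (fun a => all (fun b => all (fun c => all (fun d =>
  flips_ok [:: 5; a; b; c; d; 0]%N ==> ([:: 5; a; b; c; d; 0]%N == [:: 5; 1; 3; 2; 4; 0]%N))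
  (iota 0 6)) (iota 0 6)) (iota 0 6)) (iota 0 6) by vm_compute.
move=> a6 b6 c6 d6 ok; apply/eqP; move: ok; apply/implyP.
exact: (iota_all (iota_all (iota_all (iota_all check a6) b6) c6) d6).
Qed.

Section Uniqueness.
Local Open Scope group_scope.
Variables (D : finType) (face edge : {perm D}).
Hypothesis conn : [transitive <<[set face; edge]>>, on [set: D] | 'P].
Hypothesis rot_trans : forall d e, exists2 h : {perm D}, h \in 'C([set face; edge]) & h d = e.
Hypothesis cardD : #|D| = 60%N.
Hypothesis edgeK : forall d, edge (edge d) = d.
Hypothesis edge_neq : forall d, edge d != d.
Hypothesis face_deg : forall d, #|porbit face d| = 5%N.
Hypothesis node_deg : forall d, #|porbit (edge * face) d| = 5%N.

Let G := <<[set face; edge]>>%G.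
Let faceG : face \in G. Proof. by rewrite mem_gen ?set21. Qed.
Let edgeG : edge \in G. Proof. by rewrite mem_gen ?set22. Qed.

(** The monodromy group commutes with the rotations, and these are transitive. *)
Lemma monodromy_free g h d : g \in G -> h \in G -> g d = h d -> g = h.
Proof.
move=> gG hG gh; apply/permP => e; have [k kC <-] := rot_trans d e.
have cent u : u \in G -> u (k d) = k (u d).
  move=> uG; rewrite -!permM; congr (fun_of_perm _ d).
  have : G \subset 'C([set k]).
    rewrite gen_subG; apply/fintype.subsetP => v vS; apply/centP => _ /set1P ->.
    exact/commute_sym/(centP kC).
  by move/fintype.subsetP/(_ u uG)/centP/(_ k (set11 k)).
by rewrite !cent // gh.
Qed.

Lemma monodromy_onto d e : exists2 g, g \in G & g d = e.
Proof.
have : e \in orbit 'P G d by rewrite (atransP conn) ?inE.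
by case/orbitP => g gG <-; exists g.
Qed.

Lemma card_monodromy : #|G| = 60%N.
Proof.
have /card_gt0P[d _] : (0 < #|D|)%N by rewrite cardD.
rewrite -cardD -cardsT; have -> : [set: D] = [set g d | g : {perm D} in G].
  apply/setP => e; rewrite inE; apply/esym/imsetP.
  by have [g gG <-] := monodromy_onto d e; exists g.
by rewrite card_in_imset // => g h gG hG; exact: monodromy_free.
Qed.

Let D_neq0 : exists d : D, true.
Proof.
have /card_gt0P[d _] : (0 < #|D|)%N by rewrite cardD.
by exists d.
Qed.

Lemma order5 (f : {perm D}) : (forall d, #|porbit f d| = 5%N) -> #[f] = 5%N.
Proof.
move=> f5; have [d _] := D_neq0; apply: nt_prime_order => //.
  by apply/permP => e; rewrite permX perm1; apply/eqP; rewrite iter_fixed_dvd f5.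
apply: contra_eq_neq (f5 d) => ->; rewrite (@card_porbit_free _ _ 1) //=; first exact: perm1.
by case.
Qed.

Let P : {group {perm D}} := <[face]>%G.
Let T : {group {perm D}} := <[edge * face]>%G.
Let cardP : #|P| = 5%N. Proof. exact: order5. Qed.

Lemma syl5 (Q : {group {perm D}}) : (5.-Sylow(G) Q) = (Q \subset G) && (#|Q| == 5%N).
Proof. by rewrite pHallE card_monodromy p_part. Qed.

Let sylP : 5.-Sylow(G) P.
Proof. by rewrite syl5 cardP cycle_subG faceG. Qed.

Lemma edge_notin : edge \notin P.
Proof.
apply/negP => /order_dvdG; rewrite cardP.
suff -> : #[edge] = 2%N by [].
have [d _] := D_neq0; apply: nt_prime_order => //.
  by apply/permP => e; rewrite permX perm1 /= edgeK.
by apply: contraNneq (edge_neq d) => ->; rewrite perm1.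
Qed.

(** A single Sylow subgroup would contain [face] and [edge * face], hence [edge],
    whose order is even. *)
Lemma card_syl5 : #|'Syl_5(G)| = 6%N.
Proof.
have dv : (#|'Syl_5(G)| %| 60)%N by rewrite -card_monodromy card_Syl_dvd.
have md := @card_Syl_mod 5 _ G isT.
have : all (fun n => (n %| 60) && (n %% 5 == 1) ==> (n == 1) || (n == 6))%N (iota 0 61) by [].
move/iota_all => /(_ #|'Syl_5(G)|); rewrite leq0n /= add0n ltnS dvdn_leq // dv md eqxx /=.
move=> /(_ isT)/orP[|/eqP//] n1; case/negP: edge_notin.
have TG : T \in 'Syl_5(G).
  rewrite inE syl5 cycle_subG groupM //=; apply/eqP; exact: (order5 node_deg).
have PG : P \in 'Syl_5(G) by rewrite inE.
have TP : T = P by have /cards1P[Q QE] := n1; move: TG PG; rewrite QE !inE => /eqP-> /eqP->.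
have : edge * face \in P by rewrite -TP cycle_id.
by rewrite groupMr // cycle_id.
Qed.

(** A Sylow 5-subgroup contains every 5-element that normalises it. *)
Lemma syl5_norm (Q : {group {perm D}}) g : 5.-Sylow(G) Q -> g \in G -> g \in 'N(Q) ->
  #[g] = 5%N -> Q = <[g]>%G.
Proof.
move=> sQ gG gN g5; apply/esym/eqP; rewrite -val_eqE /= eqEcard -/(order g) g5.
have := sQ; rewrite syl5 => /andP[_ /eqP->]; rewrite leqnn andbT cycle_subG.
have nQ : normal Q (G :&: 'N(Q)) by apply: normalSG; exact: pHall_sub sQ.
have sNQ : 5.-Sylow((G :&: 'N(Q))) Q by rewrite Sylow_subnorm.
have pg : 5.-elt g by rewrite /p_elt g5.
have gNG : g \in (G :&: 'N(Q)) by rewrite inE gG.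
by rewrite (mem_normal_Hall sNQ nQ gNG).
Qed.

(** Each normaliser has order 60 / 6 = 10. An element of order 5 in both would
    generate both subgroups, so the order of their intersection divides 2. *)
Lemma syl5_two_fixed (Q Q' : {group {perm D}}) g : 5.-Sylow(G) Q -> 5.-Sylow(G) Q' ->
  Q != Q' -> g \in G -> g \in 'N(Q) -> g \in 'N(Q') -> g * g = 1.
Proof.
move=> sQ sQ' ne gG gQ gQ'; pose M := (G :&: 'N(Q)) :&: (G :&: 'N(Q')).
have cN : #|(G :&: 'N(Q))| = 10%N.
  have := Lagrange (subsetIl G 'N(Q)); rewrite -(card_Syl sQ) card_syl5 card_monodromy.
  by move/eqP; rewrite -[60%N]/(10 * 6)%N eqn_pmul2r // => /eqP.
have dM : (#|M| %| 10)%N by rewrite -cN cardSg // subsetIl.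
have n5 : ~~ (5 %| #|M|)%N.
  apply/negP => /(Cauchy (isT : prime 5))[x /setIP[/setIP[xG xQ] /setIP[_ xQ']] x5].
  by case/eqP: ne; rewrite (syl5_norm sQ xG xQ x5) (syl5_norm sQ' xG xQ' x5).
have d2 : (#|M| %| 2)%N.
  by rewrite -(@Gauss_dvdr _ 5 2) // coprime_sym prime_coprime.
apply/eqP; rewrite -[g * g]/(g ^+ 2) -order_dvdn.
by apply: dvdn_trans d2; apply: order_dvdG; apply/setIP; split; apply/setIP.
Qed.

Let conjGM (Q : {group {perm D}}) g h : (Q :^ (g * h))%G = ((Q :^ g) :^ h)%G.
Proof. by apply: val_inj; rewrite /= conjsgM. Qed.

Let conjGE (Q : {group {perm D}}) g : ((Q :^ g)%G == Q) = (g \in 'N(Q)).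
Proof. by rewrite -val_eqE /=; apply/eqP/normP. Qed.

Let sylJ (Q : {group {perm D}}) g : 5.-Sylow(G) Q -> g \in G -> 5.-Sylow(G) (Q :^ g)%G.
Proof. by move=> sQ gG; rewrite pHallJ. Qed.

Let face_norm : face \in 'N(P).
Proof. by rewrite -cycle_subG normG. Qed.

Let edge_moves : edge \notin 'N(P).
Proof.
apply/negP => eN; have /eqP := card_syl5; rewrite (card_Syl sylP).
suff -> : (G :&: 'N(P)) = G by rewrite indexgg.
apply/finset.setIidPl; rewrite gen_subG; apply/fintype.subsetP => g /set2P[]-> //.
Qed.

Let face5 : face ^+ 5 = 1.
Proof. by rewrite -(order5 face_deg) expg_order. Qed.

Let face_fixes (Q : {group {perm D}}) k : 5.-Sylow(G) Q -> (0 < k < 5)%N ->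
  face ^+ k \in 'N(Q) -> Q = P.
Proof.
move=> sQ k5 kN; apply: (@syl5_norm _ face) => //.
have [j ->] : exists j, face = (face ^+ k) ^+ j.
  have f6 n : face ^+ (n * 5 + 1) = face by rewrite expgD mulnC expgM face5 expg1n mul1g.
  (* inverses of k modulo 5 *)
  case: k k5 {kN} => [|[|[|[|[|k]]]]] // _.
  - by exists 1%N.
  - by exists 3%N; rewrite -expgM (f6 1%N).
  - by exists 2%N; rewrite -expgM (f6 1%N).
  - by exists 4%N; rewrite -expgM (f6 3%N).
exact: groupX.
Qed.

(** The six Sylow subgroups as points of the projective line: the one generated
    by [face] is at infinity, its conjugate by [edge] is 0, and conjugation by
    [face] adds 1. *)
Definition pt (i : nat) : {group {perm D}} :=
  if i == 5%N then P else (P :^ (edge * face ^+ i))%G.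

Let syl_point i : 5.-Sylow(G) (pt i).
Proof. by rewrite /pt; case: eqP => // _; apply: sylJ; rewrite ?groupM ?groupX. Qed.

Let point0 : (P :^ edge)%G = pt 0. Proof. by rewrite /pt /= expg0 mulg1. Qed.

Let point_spin i : (i < 6)%N -> (pt i :^ face)%G = pt (spin i).
Proof.
have fP : (P :^ face)%G = P by apply/eqP; rewrite conjGE.
have step k : ((P :^ (edge * face ^+ k)) :^ face)%G = (P :^ (edge * face ^+ k.+1))%G.
  by rewrite -conjGM -mulgA -expgSr.
case: i => [|[|[|[|[|[|i]]]]]] // _; try exact: step.
by apply: etrans (step 4%N) _; rewrite face5.
Qed.

Let point_lt5 k : (k < 5)%N -> pt k = ((P :^ edge) :^ (face ^+ k))%G.
Proof. by rewrite -conjGM /pt; case: eqP => // ->. Qed.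

Let base_moved : (P :^ edge)%G != P. Proof. by rewrite conjGE. Qed.

Let point_neq5 k : (k < 5)%N -> pt k != P.
Proof.
move=> k5; rewrite point_lt5 //; apply: contra base_moved => /eqP e.
have fP : (P :^ (face ^+ k))%G = P by apply/eqP; rewrite conjGE groupX.
rewrite -{2}fP in e; apply/eqP.
have : ((P :^ edge)%G :^ (face ^+ k))%G :=: (P :^ (face ^+ k))%G by rewrite e.
by move=> /= /conjsg_inj h; exact: val_inj.
Qed.

Let point_neq k l : (k < l < 5)%N -> pt k != pt l.
Proof.
case/andP => kl l5; have k5 := ltn_trans kl l5; apply/eqP => e.
have: pt k = P; last by apply/eqP/point_neq5.
apply: (@face_fixes _ (l - k)) => //.
  by rewrite subn_gt0 kl (leq_ltn_trans (leq_subr _ _)).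
by rewrite -conjGE {2}e !point_lt5 // -conjGM -expgD subnKC // ltnW.
Qed.

Let point_inj : {in iota 0 6 &, injective pt}.
Proof.
have main k l : (k < l < 6)%N -> pt k <> pt l.
  case/andP=> kl; rewrite ltnS leq_eqVlt => /orP[/eqP l5|l5].
    by rewrite l5 in kl *; apply/eqP; exact: point_neq5.
  by apply/eqP/point_neq; rewrite kl.
move=> k l; rewrite !mem_iota /= => k6 l6 e.
by case: (ltngtP k l) => // [kl|lk]; [case: (main k l) | case: (main l k)]; rewrite ?kl ?lk.
Qed.

Let point_onto (Q : {group {perm D}}) : 5.-Sylow(G) Q -> exists2 i, (i < 6)%N & Q = pt i.
Proof.
move=> sQ; have u : uniq (map pt (iota 0 6)) by rewrite map_inj_in_uniq.
have /(uniq_min_size u) : {subset map pt (iota 0 6) <= enum 'Syl_5(G)}.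
  by move=> _ /mapP[i _ ->]; rewrite mem_enum inE.
rewrite -cardE card_syl5 size_map => /(_ isT)[_ /(_ Q)].
have QS : Q \in 'Syl_5(G) by rewrite inE.
rewrite mem_enum QS => /mapP[i]; rewrite mem_iota /= => i6 ->.
by exists i.
Qed.

Definition pt_label (Q : {group {perm D}}) : nat := index Q (map pt (iota 0 6)).

Let labelK i : (i < 6)%N -> pt_label (pt i) = i.
Proof.
move=> i6; have e : pt i = nth P (map pt (iota 0 6)) i.
  by rewrite (nth_map 0%N) ?size_iota // nth_iota.
by rewrite /pt_label e index_uniq ?size_map // map_inj_in_uniq ?iota_uniq.
Qed.

Definition pt_image (i : nat) (g : {perm D}) : nat := pt_label (pt i :^ g)%G.

Let image_point i g : g \in G -> pt (pt_image i g) = (pt i :^ g)%G /\ (pt_image i g < 6)%N.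
Proof.
move=> gG; have [j j6 e] := point_onto (sylJ (syl_point i) gG).
by rewrite /pt_image e labelK.
Qed.

Let imageM i g h : g \in G -> h \in G -> pt_image i (g * h) = pt_image (pt_image i g) h.
Proof.
move=> gG hG; rewrite -[RHS]/(pt_label (pt (pt_image i g) :^ h)%G) (image_point i gG).1.
by rewrite -conjGM.
Qed.

Let image1 i : (i < 6)%N -> pt_image i 1 = i.
Proof.
move=> i6; rewrite /pt_image; have -> : (pt i :^ 1)%G = pt i; last exact: labelK.
by apply: val_inj; rewrite /= conjsg1.
Qed.

Let spin_lt i : (i < 6)%N -> (spin i < 6)%N. Proof. by case: i => [|[|[|[|[|[|i]]]]]]. Qed.

Let image_face i : (i < 6)%N -> pt_image i face = spin i.
Proof. by move=> i6; rewrite /pt_image point_spin // labelK ?spin_lt. Qed.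

Let image_two_fixed g i j k : g \in G -> (i < 6)%N -> (j < 6)%N -> (k < 6)%N -> i != j ->
  pt_image i g = i -> pt_image j g = j -> pt_image k (g * g) = k.
Proof.
move=> gG i6 j6 k6 ij gi gj.
have fixed l : pt_image l g = l -> g \in 'N(pt l).
  by move=> gl; rewrite -conjGE -(image_point l gG).1 gl.
rewrite (@syl5_two_fixed (pt i) (pt j)) ?image1 ?fixed //.
by apply: contraNneq ij => /point_inj; rewrite !mem_iota /= => ->.
Qed.

Definition flips : seq nat := mkseq (fun i => pt_image i edge) 6.

Definition word_perm (w : seq bool) : {perm D} :=
  foldr (fun b g => (if b then edge else face) * g) 1 w.

Let word_permG w : word_perm w \in G.
Proof. by elim: w => [|[] w IH] /=; rewrite ?group1 ?groupM. Qed.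

Let word_perm_cat v w : word_perm (v ++ w) = word_perm v * word_perm w.
Proof. by elim: v => [|b v IH] /=; rewrite ?mul1g // IH mulgA. Qed.

Let word_actE w i : (i < 6)%N -> word_act flips w i = pt_image i (word_perm w).
Proof.
elim: w i => [|b w IH] i i6 /=; first by rewrite image1.
have e : (if b then nth 0%N flips i else spin i) = pt_image i (if b then edge else face).
  by case: b; [rewrite nth_mkseq | rewrite image_face].
have gG : (if b then edge else face) \in G by case: (b).
have [_ lt6] := image_point i gG; rewrite -e in lt6.
apply: etrans (IH _ lt6) _; rewrite e; apply/esym; exact: imageM gG (word_permG w).
Qed.

Let flips_sound : flips_ok flips.
Proof.
have trivial w : word_perm w = 1 -> forall i, (i < 6)%N -> word_act flips w i = i.
  by move=> w1 i i6; rewrite word_actE // w1 image1.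
have two w : word_fixes_two flips w ==> word_square_trivial flips w.
  apply/implyP; rewrite /word_fixes_two -size_filter => two.
  have u : uniq [seq i <- iota 0 6 | word_act flips w i == i].
    by rewrite filter_uniq ?iota_uniq.
  case E : [seq i <- iota 0 6 | _] two u => [|i [|j l]] // _ /= /andP[]; rewrite inE negb_or.
  case/andP => ij _ _.
  have : j \in i :: j :: l by rewrite !inE eqxx orbT.
  have : i \in i :: j :: l by rewrite !inE eqxx.
  rewrite -E !mem_filter !mem_iota /= => /andP[/eqP wi i6] /andP[/eqP wj j6].
  apply/allP => k; rewrite mem_iota /= => k6; apply/eqP.
  rewrite word_actE // word_perm_cat.
  by apply: (image_two_fixed _ i6 j6); rewrite -?word_actE.
apply/and4P; split=> //.
- apply/allP => i; rewrite mem_iota => /andP[_ i6]; apply/eqP; apply: trivial i6.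
  by apply/permP => d; rewrite /= !permM !perm1 edgeK.
- apply/allP => i; rewrite mem_iota => /andP[_ i6]; apply/eqP; apply: trivial i6.
  transitivity ((edge * face) ^+ 5); first by rewrite /= mulg1 !expgS expg0 mulg1 !mulgA.
  by rewrite -(order5 node_deg) expg_order.
Qed.

Let image_edge i : (i < 6)%N -> pt_image i edge = flip i.
Proof.
have f0 : pt_image 0 edge = 5%N.
  apply: etrans (labelK (isT : 5 < 6)%N); rewrite /pt_image -point0 -conjGM.
  have -> : edge * edge = 1 by apply/permP => d; rewrite permM perm1 edgeK.
  by congr pt_label; apply: val_inj; rewrite /= conjsg1.
have f5 : pt_image 5 edge = 0%N by rewrite /pt_image /pt /= -/P point0 labelK.
have lt j : (pt_image j edge < 6)%N by case: (image_point j edgeG).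
have fE : flips = [:: 5; pt_image 1 edge; pt_image 2 edge; pt_image 3 edge; pt_image 4 edge; 0]%N.
  by rewrite /flips /mkseq /= f0 f5.
have ok := flips_sound; rewrite fE in ok.
have [e1 e2 e3 e4] := flips_unique (lt 1%N) (lt 2%N) (lt 3%N) (lt 4%N) ok.
by case: i => [|[|[|[|[|[|i]]]]]].
Qed.

(** Conjugation on the six points sends the monodromy group, one element for each
    dart, to PSL(2,5), with [face] going to [spin] and [edge] to [flip]. It is onto
    because these two generate PSL(2,5), and both sides have sixty elements. *)
Lemma ico_unique : exists (h : icodart -> D) (g : D -> icodart), [/\ cancel h g, cancel g h,
  forall w, h (ico_face w) = face (h w) & forall w, h (ico_edge w) = edge (h w)].
Proof.
have [d0 _] := D_neq0.
pose mon d := odflt 1 [pick g in G | g d0 == d].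
have monP d : mon d \in G /\ mon d d0 = d.
  rewrite /mon; case: pickP => [g /andP[gG /eqP]|none] //=.
  by have [g gG gd] := monodromy_onto d0 d; have := none g; rewrite gG gd eqxx.
have monE g d : g \in G -> g d0 = d -> mon d = g.
  by move=> gG gd; have [mG md] := monP d; apply: (@monodromy_free _ _ d0); rewrite ?md.
have mon_face d : mon (face d) = mon d * face.
  by have [mG md] := monP d; apply: monE; rewrite ?groupM // permM md.
have mon_edge d : mon (edge d) = mon d * edge.
  by have [mG md] := monP d; apply: monE; rewrite ?groupM // permM md.
pose F d := [seq pt_image i (mon d) | i <- iota 0 6].
have F_face d : F (face d) = map spin (F d).
  rewrite /F mon_face -map_comp; apply/eq_in_map => i; rewrite mem_iota => /andP[_ i6].
  have [mG _] := monP d; have [_ lt6] := image_point i mG.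
  by rewrite imageM // image_face.
have F_edge d : F (edge d) = map flip (F d).
  rewrite /F mon_edge -map_comp; apply/eq_in_map => i; rewrite mem_iota => /andP[_ i6].
  have [mG _] := monP d; have [_ lt6] := image_point i mG.
  by rewrite imageM // image_edge.
have F0 : F d0 = iota 0 6.
  rewrite /F (monE 1) ?group1 ?perm1 // -[RHS]map_id; apply/eq_in_map => i.
  by rewrite mem_iota /= => i6; rewrite image1.
have [w0 w0E] := ico_base.
have F_in : forall d, F d \in psl.
  apply: (dart_ind conn (d0 := d0)) => [|d|d] /=; first by rewrite F0 -w0E; exact: ssvalP.
    by rewrite F_face => /(allP psl_spin).
  by rewrite F_edge => /(allP psl_flip).
pose g d : icodart := SeqSub (F_in d).
have g_face d : g (face d) = ico_face (g d).
  by apply: ico_inj; rewrite (ico_face_val 1) /= F_face.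
have g_edge d : g (edge d) = ico_edge (g d).
  by apply: ico_inj; rewrite ico_edge_val /= F_edge.
have g_onto w : exists d, g d = w.
  apply: (ico_ind w0E (P := fun w => exists d, g d = w)) => [|_ [d <-]|_ [d <-]].
  - by exists d0; apply: ico_inj; rewrite w0E.
  - by exists (face d).
  - by exists (edge d).
have g_inj : injective g.
  have /imset_injP inj : #|g @: [set: D]| == #|[set: D]|.
    have -> : g @: [set: D] = [set: icodart].
      by apply/setP => w; rewrite inE; have [d <-] := g_onto w; rewrite imset_f.
    by rewrite !cardsT card_ico cardD.
  by move=> d e /inj; apply; rewrite inE.
have [h gK hK] : bijective g by apply: inj_card_bij g_inj _; rewrite card_ico cardD.
exists h, g; split=> // w; apply: g_inj; rewrite ?g_face ?g_edge !hK //.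
Qed.

End Uniqueness.

(** * Regular pentagons in the Klein model *)

Section Pentagon.
Local Open Scope classical_set_scope.
Local Open Scope ring_scope.
Context (R : realType).
Implicit Types (k q : nat) (z w : R * R).

Local Notation theta := (pi / 5%:R : R).

Let thetaMn n : theta *+ n = theta * n%:R. Proof. by rewrite mulr_natr. Qed.

(** Together with the height over the base side, a system of orthonormal
    coordinates: the component along that side. *)
Definition slide z : R := z.2 * cos theta - z.1 * sin theta.

Lemma height0E z : height 5 0 z = z.1 * cos theta + z.2 * sin theta.
Proof. by rewrite /height !muln0 !add0n !mulr1. Qed.

Lemma heightE k z :
  height 5 k z = height 5 0 z * cos (theta *+ (2 * k)) +
                 slide z * sin (theta *+ (2 * k)).
Proof.
rewrite height0E /slide /height.
have -> : pi * (2 * k + 1)%:R / 5%:R = theta + theta *+ (2 * k) :> R.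
  by rewrite -mulrS thetaMn addn1 mulrAC.
rewrite cosD sinD; ring.
Qed.

Lemma height_inj z w :
  height 5 0 z = height 5 0 w -> slide z = slide w -> z = w.
Proof.
rewrite !height0E /slide => e1 e2.
have h := cos2Dsin2 theta.
case: z w e1 e2 => [x y] [x' y'] /= e1 e2.
have ex v v' : v = (v * cos theta + v' * sin theta) * cos theta
                  - (v' * cos theta - v * sin theta) * sin theta.
  by rewrite -[LHS]mulr1 -[X in _ * X = _]h; ring.
have ey v v' : v' = (v * cos theta + v' * sin theta) * sin theta
                  + (v' * cos theta - v * sin theta) * cos theta.
  by rewrite -[LHS]mulr1 -[X in _ * X = _]h; ring.
by congr (_, _); [rewrite (ex x y) e1 e2 -ex | rewrite (ey x y) e1 e2 -ey].
Qed.

Lemma height_period k z : height 5 (k + 5) z = height 5 k z.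
Proof.
rewrite heightE [RHS]heightE mulnDr mulrnDr.
have -> : theta *+ (2 * 5) = pi *+ 2.
  by rewrite !thetaMn mulr2n; field.
by rewrite cosD2pi sinD2pi.
Qed.

Lemma height_turn k z : height 5 k.+1 (turn 5 z) = height 5 k z.
Proof.
rewrite /height /turn /=.
have -> : pi * (2 * k.+1 + 1)%:R / 5%:R = pi * (2 * k + 1)%:R / 5%:R + 2 * pi / 5%:R :> R.
  by rewrite mulnS -addnA natrD; ring.
rewrite cosD sinD.
have h := cos2Dsin2 (2 * pi / 5%:R : R).
by rewrite -[RHS]mulr1 -[X in _ = _ * X]h; ring.
Qed.

Lemma cos1_gt : 0 < cos theta.
Proof. by apply: cos_gt0_pihalf; have := @pi_gt0 R; lra. Qed.
Lemma sin1_gt : 0 < sin theta.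
Proof. by apply: sin_gt0_pi; have := @pi_gt0 R; lra. Qed.
Lemma sin2_gt : 0 < sin (theta *+ 2).
Proof. by apply: sin_gt0_pi; rewrite thetaMn; have := @pi_gt0 R; lra. Qed.
Lemma sin4_gt : 0 < sin (theta *+ 4).
Proof. by apply: sin_gt0_pi; rewrite thetaMn; have := @pi_gt0 R; lra. Qed.
Lemma theta6 : theta *+ 6 = - (theta *+ 4) + pi *+ 2.
Proof. by rewrite !thetaMn mulr2n; field. Qed.
Lemma theta8 : theta *+ 8 = - (theta *+ 2) + pi *+ 2.
Proof. by rewrite !thetaMn mulr2n; field. Qed.

Lemma height1E z : height 5 1 z =
  height 5 0 z * cos (theta *+ 2) + slide z * sin (theta *+ 2).
Proof. exact: heightE. Qed.
Lemma height2E z : height 5 2 z =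
  height 5 0 z * cos (theta *+ 4) + slide z * sin (theta *+ 4).
Proof. exact: heightE. Qed.
Lemma height3E z : height 5 3 z =
  height 5 0 z * cos (theta *+ 4) - slide z * sin (theta *+ 4).
Proof. by rewrite heightE theta6 cosD2pi sinD2pi cosN sinN mulrN. Qed.
Lemma height4E z : height 5 4 z =
  height 5 0 z * cos (theta *+ 2) - slide z * sin (theta *+ 2).
Proof. by rewrite heightE theta8 cosD2pi sinD2pi cosN sinN mulrN. Qed.

Variable q : nat.
Local Notation rho := (circumradius R 5 q).
Local Notation a := (apothem R 5 q).
Local Notation c0 := (corner R 5 q 0).
Local Notation c1 := (corner R 5 q 1).

Definition cross z : R * R := c0 + c1 - z.

Lemma corner0E : c0 = (rho, 0).
Proof. by rewrite /corner mulr0 mul0r cos0 sin0 mulr1 mulr0. Qed.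

Lemma corner1E : c1 = turn 5 c0.
Proof.
rewrite corner0E /turn /corner /= !mulr0 subr0 addr0 mulr1.
by rewrite [rho * _]mulrC [rho * _]mulrC.
Qed.

Lemma height0_corner0 : height 5 0 c0 = a.
Proof. by rewrite height0E corner0E /= mul0r addr0. Qed.
Lemma slide_corner0 : slide c0 = - (rho * sin theta).
Proof. by rewrite /slide corner0E /= mul0r add0r. Qed.
Lemma height0_corner1 : height 5 0 c1 = a.
Proof.
have h := height_turn 4 c0; rewrite -corner1E in h.
rewrite -(height_period 0) h height4E height0_corner0 slide_corner0 /apothem.
rewrite mulr2n cosD sinD.
by rewrite -[RHS]mulr1 -[X in _ = _ * X](cos2Dsin2 theta); ring.
Qed.
Lemma slide_corner1 : slide c1 = rho * sin theta.
Proof.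
rewrite corner1E corner0E /turn /slide /= !mulr0 subr0 addr0.
have -> : 2 * pi / 5%:R = theta *+ 2 :> R by rewrite thetaMn; ring.
rewrite mulr2n cosD sinD.
by rewrite -[RHS]mulr1 -[X in _ = _ * X](cos2Dsin2 theta); ring.
Qed.

Lemma height0_cross z : height 5 0 (cross z) = a + a - height 5 0 z.
Proof.
transitivity (height 5 0 c0 + height 5 0 c1 - height 5 0 z).
  by rewrite !height0E /cross /=; ring.
by rewrite height0_corner0 height0_corner1.
Qed.
Lemma slide_cross z : slide (cross z) = - slide z.
Proof.
have : slide (cross z) = slide c0 + slide c1 - slide z by rewrite /slide /cross /=; ring.
by rewrite slide_corner0 slide_corner1 addNr sub0r.
Qed.

(** The distance to the line of side [k], negative beyond it. *)
Definition gap k z : R := a - height 5 k z.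

Lemma gap_turn k z : gap k.+1 (turn 5 z) = gap k z.
Proof. by rewrite /gap height_turn. Qed.
Lemma gap_period k z : gap (k + 5) z = gap k z.
Proof. by rewrite /gap height_period. Qed.

Lemma gap_mod k z : gap (k %% 5) z = gap k z.
Proof.
rewrite {2}(divn_eq k 5) addnC; elim: (k %/ 5)%N => [|n IH]; first by rewrite addn0.
by rewrite mulSn [(5 + _)%N]addnC addnA gap_period.
Qed.

Lemma polygonP z : polygon 5 q z <-> forall k, 0 <= gap k z.
Proof.
split=> [h k|h k _]; last by rewrite -subr_ge0; exact: h.
by rewrite -gap_mod subr_ge0; apply: h; rewrite ltn_mod.
Qed.

Lemma polygon_turn z : polygon 5 q (turn 5 z) <-> polygon 5 q z.
Proof.
rewrite !polygonP; split=> h k; first by rewrite -gap_turn.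
case: k => [|k]; last by rewrite gap_turn.
by rewrite -(gap_period 0) gap_turn.
Qed.

(** On the base side the gluing map agrees with the reflection in the axis of that
    side, which exchanges the other four sides in pairs. *)
Lemma gap_cross z : gap 0 z = 0 ->
  [/\ gap 0 (cross z) = 0, gap 1 (cross z) = gap 4 z, gap 2 (cross z) = gap 3 z,
      gap 3 (cross z) = gap 2 z & gap 4 (cross z) = gap 1 z].
Proof.
rewrite /gap => /eqP; rewrite subr_eq0 => /eqP ha.
rewrite !(height1E, height2E, height3E, height4E) !height0_cross !slide_cross -!ha.
by split; ring.
Qed.

Lemma base_sideP z : base_side 5 q z <-> polygon 5 q z /\ gap 0 z = 0.
Proof.
split=> -[h1 h2]; split=> //; first by rewrite /gap h2 subrr.
by apply/esym/eqP; rewrite -subr_eq0; apply/eqP.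
Qed.

Lemma gap5P (P : R -> Prop) z :
  P (gap 0 z) -> P (gap 1 z) -> P (gap 2 z) -> P (gap 3 z) -> P (gap 4 z) ->
  forall k, P (gap k z).
Proof.
move=> ? ? ? ? ? k; rewrite -gap_mod.
have : (k %% 5 < 5)%N by rewrite ltn_mod.
by case: (k %% 5)%N => [|[|[|[|[|i]]]]] //; rewrite !ltnS ltn0.
Qed.

Lemma base_side_cross z : base_side 5 q z -> base_side 5 q (cross z).
Proof.
rewrite !base_sideP => -[/polygonP hz g0].
have [h0 h1 h2 h3 h4] := gap_cross g0; split=> //.
by apply/polygonP; apply: (@gap5P (fun x => 0 <= x)); rewrite ?h0 ?h1 ?h2 ?h3 ?h4.
Qed.

Lemma gap1_base z : gap 0 z = 0 -> gap 1 z = (rho * sin theta - slide z) * sin (theta *+ 2).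
Proof.
rewrite /gap height1E => /eqP; rewrite subr_eq0 => /eqP <-.
rewrite /apothem cos_mulr2n sin_mulr2n !mulr2n.
rewrite cos2sin2; ring.
Qed.
Lemma gap4_base z : gap 0 z = 0 -> gap 4 z = (rho * sin theta + slide z) * sin (theta *+ 2).
Proof.
rewrite /gap height4E => /eqP; rewrite subr_eq0 => /eqP <-.
rewrite /apothem cos_mulr2n sin_mulr2n !mulr2n.
rewrite cos2sin2; ring.
Qed.
Let trig4 : cos theta * (1 - cos (theta *+ 4)) =
  sin theta * sin (theta *+ 4) + 2 * sin (theta *+ 2) * sin theta.
Proof.
have c2 := cos_mulr2n theta; have s2 := sin_mulr2n theta.
have c4 := cos_mulr2n (theta *+ 2); have s4 := sin_mulr2n (theta *+ 2).
rewrite -mulrnA cos2sin2 in c4; rewrite -mulrnA in s4; rewrite c4 s4 c2 s2 !mulr2n; ring.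
Qed.
Lemma gap2_base z : gap 0 z = 0 -> gap 2 z =
  (rho * sin theta - slide z) * sin (theta *+ 4) + 2 * rho * sin (theta *+ 2) * sin theta.
Proof.
rewrite /gap height2E => /eqP; rewrite subr_eq0 => /eqP <-.
rewrite /apothem.
transitivity (rho * (cos theta * (1 - cos (theta *+ 4))) - slide z * sin (theta *+ 4)).
  by ring.
by rewrite trig4; ring.
Qed.
Lemma gap3_base z : gap 0 z = 0 -> gap 3 z =
  (rho * sin theta + slide z) * sin (theta *+ 4) + 2 * rho * sin (theta *+ 2) * sin theta.
Proof.
rewrite /gap height3E => /eqP; rewrite subr_eq0 => /eqP <-.
rewrite /apothem.
transitivity (rho * (cos theta * (1 - cos (theta *+ 4))) + slide z * sin (theta *+ 4)).
  by ring.
by rewrite trig4; ring.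
Qed.

Hypothesis rho_gt0 : 0 < rho.

Lemma apothem_gt0 : 0 < a.
Proof. by rewrite mulr_gt0 // cos1_gt. Qed.

Lemma origin_polygon : polygon 5 q (0 : R * R).
Proof. by move=> k _; rewrite /height /= !mul0r addr0 ltW // apothem_gt0. Qed.

(** The base side touches only the two sides next to it. *)
Lemma base_side_gap23 z : base_side 5 q z -> 0 < gap 2 z /\ 0 < gap 3 z.
Proof.
case/base_sideP=> /polygonP h g0.
have h1 := h 1%N; have h4 := h 4%N; move: h1 h4.
rewrite gap2_base // gap3_base // gap1_base // gap4_base //.
rewrite !pmulr_lge0 ?sin2_gt // => h1 h4.
have hp : 0 < 2 * rho * sin (theta *+ 2) * sin theta.
  by rewrite !mulr_gt0 ?sin2_gt ?sin1_gt ?ltr0n.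
by split; apply: ltr_wpDl => //; rewrite mulr_ge0 // ltW // sin4_gt.
Qed.

Lemma gap1_eq0 z : gap 0 z = 0 -> gap 1 z = 0 -> z = c1.
Proof.
move=> g0; rewrite gap1_base // => /eqP; rewrite mulf_eq0 [sin _ == 0]gt_eqF ?sin2_gt // orbF.
rewrite subr_eq0 => /eqP h; apply: height_inj; last by rewrite slide_corner1.
by rewrite height0_corner1; apply/esym/eqP; rewrite -subr_eq0; apply/eqP.
Qed.
Lemma gap4_eq0 z : gap 0 z = 0 -> gap 4 z = 0 -> z = c0.
Proof.
move=> g0; rewrite gap4_base // => /eqP; rewrite mulf_eq0 [sin _ == 0]gt_eqF ?sin2_gt // orbF.
rewrite addrC addr_eq0 => /eqP h; apply: height_inj; last by rewrite slide_corner0.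
by rewrite height0_corner0; apply/esym/eqP; rewrite -subr_eq0; apply/eqP.
Qed.

Lemma gap_corner0 : [/\ gap 0 c0 = 0, 0 < gap 1 c0, 0 < gap 2 c0, 0 < gap 3 c0 & gap 4 c0 = 0].
Proof.
have g0 : gap 0 c0 = 0 by rewrite /gap height0_corner0 subrr.
rewrite gap1_base // gap2_base // gap3_base // gap4_base // slide_corner0 opprK.
have rs : 0 < rho * sin theta by rewrite mulr_gt0 // sin1_gt.
have hp : 0 < 2 * rho * sin (theta *+ 2) * sin theta.
  by rewrite !mulr_gt0 ?sin2_gt ?sin1_gt ?ltr0n.
rewrite subrr !mul0r add0r; split=> //.
  by rewrite mulr_gt0 ?sin2_gt // addr_gt0.
by rewrite addr_gt0 // mulr_gt0 ?sin4_gt // addr_gt0.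
Qed.

Lemma base_side_corner0 : base_side 5 q c0.
Proof.
have [g0 g1 g2 g3 g4] := gap_corner0; apply/base_sideP; split=> //.
by apply/polygonP; apply: (@gap5P (fun x => 0 <= x)); rewrite ?g0 ?g4 // ltW.
Qed.

Lemma cross_corner0 : cross c0 = c1. Proof. by rewrite /cross addrAC subrr add0r. Qed.

Lemma gap_inj z w : gap 0 z = gap 0 w -> gap 1 z = gap 1 w -> z = w.
Proof.
rewrite /gap => /addrI/oppr_inj h0 /addrI/oppr_inj; rewrite !height1E h0.
move=> /addrI/(mulIf _) h; apply: height_inj => //; apply: h.
by rewrite gt_eqF ?sin2_gt.
Qed.

Lemma gap14_inj z w : gap 0 z = gap 0 w -> gap 1 z - gap 4 z = gap 1 w - gap 4 w -> z = w.
Proof.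
rewrite /gap => /addrI/oppr_inj h0; rewrite !height1E !height4E h0 => h.
apply: height_inj => //; apply: (@mulIf _ (sin (theta *+ 2))); last by lra.
by rewrite gt_eqF ?sin2_gt.
Qed.

Lemma height_continuous k : continuous (height 5 k : R * R -> R).
Proof.
move=> z; rewrite /height; apply: cvgD; apply: cvgM; try exact: cvg_cst.
  exact: cvg_fst.
exact: cvg_snd.
Qed.

Lemma gap_continuous k : continuous (gap k : R * R -> R).
Proof. by move=> z; apply: cvgB; [exact: cvg_cst | exact: height_continuous]. Qed.

Lemma polygon_compact : compact (polygon 5 q : set (R * R)).
Proof.
have cl : closed (polygon 5 q : set (R * R)).
  have -> : polygon 5 q = \bigcap_k (gap k @^-1` [set x : R | 0 <= x]).
    apply/seteqP; split=> z /=; first by move/polygonP=> h k _; exact: h.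
    by move=> h; apply/polygonP => k; exact: h.
  apply: closed_bigI => k _; apply: closed_comp; last exact: closed_ge.
  by move=> z _; exact: gap_continuous.
have s1 : 0 < sin theta := sin1_gt; have k1 : 0 < cos theta := cos1_gt.
pose N := (a + a * cos theta) / sin theta.
apply: (@subclosed_compact _ _ (`[- a, rho] `*` `[- N, N])) => //.
  by apply: compact_setX; exact: segment_compact.
move=> [x y] /polygonP h.
have hx : 0 <= a + x.
  have := h 2%N; rewrite /gap /height /=.
  (* the outer normal of side 2 points to the left *)
  have -> : pi * (2 * 2 + 1)%:R / 5%:R = pi :> R by field.
  by rewrite cospi sinpi; lra.
have := h 0%N; have := h 4%N.
rewrite /gap height0E /height /=.
have -> : pi * (2 * 4 + 1)%:R / 5%:R = - theta + pi *+ 2 :> R by rewrite mulr2n; field.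
rewrite cosD2pi sinD2pi cosN sinN => h4 h0.
have hc : - a * cos theta <= x * cos theta by rewrite ler_pM2r //; lra.
split=> /=; rewrite in_itv /=; apply/andP; split; first by lra.
- by rewrite -(ler_pM2r k1); move: h0 h4; rewrite {1 2}/apothem; lra.
- by rewrite -(ler_pM2r s1) mulNr divfK ?gt_eqF //; lra.
- by rewrite -(ler_pM2r s1) divfK ?gt_eqF //; lra.
Qed.
End Pentagon.

Section Scaling.
Local Open Scope classical_set_scope.
Local Open Scope ring_scope.
Context (R : realType).

(** Both angles are less than pi / 4, so both tangents are less than 1. *)
Lemma circumradius_gt0 q : (4 < q)%N -> 0 < circumradius R 5 q.
Proof.
have p0 := @pi_gt0 R.
have dom (x : R) : 0 <= x -> x <= pi / 4%:R -> x \in `](- (pi / 2)), (pi / 2)[%R.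
  by move=> x0 x4; rewrite in_itv /=; apply/andP; split; lra.
have tan_lt1 n : (4 < n)%N -> 0 < tan (pi / n%:R : R) < 1.
  move=> n4; have n0 : 0 < n%:R :> R by rewrite ltr0n; case: n n4.
  have lt4 : pi / n%:R < pi / 4%:R :> R by rewrite ltr_pM2l // ltf_pV2 ?posrE ?ltr_nat // ltr0n.
  have gt0 : 0 < pi / n%:R :> R by rewrite divr_gt0.
  have p4 : 0 < pi / 4%:R :> R by rewrite divr_gt0.
  rewrite -[X in _ < _ < X]tan_piquarter -[X in X < _ < _](@tan0 R).
  by rewrite !ltr_tan ?gt0 ?lt4 //; apply: dom => //; apply: ltW.
move=> q4; have /andP[t0 t1] := tan_lt1 5 isT; have /andP[q0 q1] := tan_lt1 q q4.
have lt1 : tan (pi / 5%:R) * tan (pi / q%:R) < 1 :> R by rewrite mulr_ilt1 // ltW.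
by rewrite sqrtr_gt0 subr_gt0 exprn_ilt1 // mulr_ge0 // ltW.
Qed.

Variables q q' : nat.
Hypotheses (q4 : (4 < q)%N) (q'4 : (4 < q')%N).

Let ratio : R := circumradius R 5 q' / circumradius R 5 q.
Let ratio_gt0 : 0 < ratio. Proof. by rewrite divr_gt0 ?circumradius_gt0. Qed.

(** In the Klein model the pentagons of types {5,q} and {5,q'} are homothetic. *)
Definition rescale (z : R * R) : R * R := (ratio * z.1, ratio * z.2).

Lemma gap_rescale k z : gap q' k (rescale z) = ratio * gap q k z.
Proof.
have e : apothem R 5 q' = ratio * apothem R 5 q.
  by rewrite /apothem mulrA divfK // gt_eqF ?circumradius_gt0.
by rewrite /gap e /height /=; ring.
Qed.

Lemma polygon_rescale z : polygon 5 q' (rescale z) <-> polygon 5 q z.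
Proof.
rewrite !polygonP; split=> h k; have := h k; rewrite gap_rescale pmulr_rge0 //.
Qed.

Lemma base_side_rescale z : base_side 5 q' (rescale z) <-> base_side 5 q z.
Proof.
rewrite !base_sideP polygon_rescale gap_rescale; split=> -[hz h]; split=> //.
  by apply/eqP; move/eqP: h; rewrite mulf_eq0 gt_eqF.
by rewrite h mulr0.
Qed.

Lemma rescale_turn z : rescale (turn 5 z) = turn 5 (rescale z).
Proof. by rewrite /rescale /turn /=; congr (_, _); ring. Qed.

Lemma rescale_corner0 : rescale (corner R 5 q 0) = corner R 5 q' 0.
Proof.
by rewrite !corner0E /rescale /= mulr0 divfK // gt_eqF ?circumradius_gt0.
Qed.

Lemma rescale_cross z : rescale (cross q z) = cross q' (rescale z).
Proof.
rewrite /cross !corner1E -!rescale_corner0 -rescale_turn /rescale.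
by congr (_, _); rewrite /=; ring.
Qed.

Lemma rescale_continuous : continuous rescale.
Proof.
move=> z; apply: (@cvg_pair _ _ _ _ (nbhs (ratio * z.1)) (nbhs (ratio * z.2))).
  by apply: cvgM; [exact: cvg_cst | exact: cvg_fst].
by apply: cvgM; [exact: cvg_cst | exact: cvg_snd].
Qed.
End Scaling.

Section Rescaling.
Local Open Scope classical_set_scope.
Local Open Scope ring_scope.
Lemma rescaleK (R : realType) q q' : (4 < q)%N -> (4 < q')%N ->
  cancel (@rescale R q q') (@rescale R q' q).
Proof.
have neq0 n : (4 < n)%N -> circumradius R 5 n != 0.
  by move=> ?; rewrite gt_eqF ?circumradius_gt0.
move=> /neq0 ? /neq0 ? [x y]; rewrite /rescale /=.
by congr (_, _); field; apply/andP.
Qed.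
End Rescaling.

(** * Functions separating the points of a glued surface *)

Section Turning.
Local Open Scope classical_set_scope.
Local Open Scope ring_scope.
Context (R : realType).
Variable q : nat.
Implicit Types z : R * R.

(** A point is determined by its distances to two adjacent sides, and these are
    permuted cyclically by a turn. *)
Lemma turn5 z : iter 5 (turn 5) z = z.
Proof. by apply: (@gap_inj _ q); rewrite -gap_period !gap_turn. Qed.

Definition back z : R * R := iter 4 (turn 5) z.

Lemma backK : cancel back (turn 5). Proof. exact: turn5. Qed.
Lemma gap_back k z : gap q k (back z) = gap q k.+1 z.
Proof. by rewrite -[in RHS](backK z) gap_turn. Qed.

Lemma gap_iter_back k n z : gap q k (iter n back z) = gap q (n + k) z.
Proof. by elim: n k => //= n IH k; rewrite gap_back IH addnS. Qed.

Lemma polygon_back z : polygon 5 q z -> polygon 5 q (back z).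
Proof. by rewrite -{1}(backK z) polygon_turn. Qed.

Lemma polygon_iter_back n z : polygon 5 q z -> polygon 5 q (iter n back z).
Proof. by elim: n => //= n IH /IH/polygon_back. Qed.

End Turning.
Arguments back {R} z.

Section Gluing.
Local Open Scope classical_set_scope.
Local Open Scope ring_scope.
Context (R : realType).
Variables (q : nat) (q4 : (4 < q)%N).
Variables (D : finType) (face edge : {perm D}).
Hypothesis edgeK : forall d, edge (edge d) = d.
Hypothesis edge_neq : forall d, edge d != d.
Hypothesis face5 : forall d, iter 5 face d = d.
Hypothesis face_free : forall d k, (k < 5)%N -> iter k face d = d -> k = 0.

Local Notation node := (edge * face)%g.
Local Notation glue := (@glued R 5 q D face edge).
Local Notation c0 := (corner R 5 q 0).
Local Notation c1 := (corner R 5 q 1).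
Local Notation rho_gt0 := (circumradius_gt0 R q4).

Lemma glued_refl x : glue x x. Proof. exact: rst_refl. Qed.
Lemma glued_sym x y : glue x y -> glue y x. Proof. exact: rst_sym. Qed.
Lemma glued_trans y x z : glue x y -> glue y z -> glue x z.
Proof. exact: rst_trans. Qed.

Lemma glued_turn d z : polygon 5 q z -> glue (face d, z) (d, turn 5 z).
Proof. by move=> hz; apply: rst_step; constructor. Qed.

Lemma glued_cross d z : base_side 5 q z -> glue (d, z) (edge d, cross q z).
Proof. by move=> hz; apply: rst_step; exact: Cross_step. Qed.

Lemma glued_back d z : polygon 5 q z -> glue (d, z) (face d, back z).
Proof.
move=> hz; apply: glued_sym; rewrite -{2}(backK q z); apply: glued_turn.
exact: polygon_back.
Qed.

Lemma glued_iter_back n d z : polygon 5 q z ->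
  glue (d, z) (iter n face d, iter n back z).
Proof.
move=> hz; elim: n => [|n IH] /=; first exact: glued_refl.
by apply: glued_trans IH _; apply: glued_back; apply: polygon_iter_back.
Qed.

Lemma glued_node d : glue (d, c0) (node d, c0).
Proof.
have b0 := base_side_corner0 rho_gt0.
apply: glued_trans (glued_cross d b0) _.
rewrite cross_corner0 corner1E permM; apply: glued_sym; apply: glued_turn.
by case: b0.
Qed.

Lemma glued_node_orbit d e : e \in porbit node d -> glue (d, c0) (e, c0).
Proof.
case/porbitP=> n ->; elim: n => [|n IH]; first by rewrite expg0 perm1; exact: glued_refl.
by apply: glued_trans IH _; rewrite expgSr permM; exact: glued_node.
Qed.

Lemma glued_polygon x y : glue x y -> polygon 5 q x.2 <-> polygon 5 q y.2.
Proof.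
elim=> [_ _ [d z|d z]| | ? ? _ ->| ? ? ? _ -> _ ->] //=.
  by rewrite polygon_turn.
by move=> b; have := base_side_cross b; case: b => ? _ [? _]; split.
Qed.

Section Kernel.
Variable phi : R -> R -> R -> R -> R -> R.

(** [phi] sees the five side distances from side [k], so that a turn of the tile
    shifts [k]. *)
Definition side_kernel k z :=
  phi (gap q k z) (gap q k.+1 z) (gap q k.+2 z) (gap q k.+3 z) (gap q k.+4 z).

(** Every side [e] of the tile contributes its kernel with the weight [W e]. A turn
    permutes the summands, so the sum does not depend on the side from which the
    tile is described. *)
Definition wsum (W : D -> R) (x : D * (R * R)) : R :=
  \sum_(k < 5) W (iter k face x.1) * side_kernel k x.2.

Lemma kernel_period k z : side_kernel (k + 5) z = side_kernel k z.
Proof. by rewrite /side_kernel -!addSn !gap_period. Qed.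

Lemma kernel_turn k z : side_kernel k.+1 (turn 5 z) = side_kernel k z.
Proof. by rewrite /side_kernel !gap_turn. Qed.

Lemma wsum_turn W d z : wsum W (face d, z) = wsum W (d, turn 5 z).
Proof.
rewrite /wsum [LHS]big_ord_recr [RHS]big_ord_recl /= [LHS]addrC; congr (_ + _).
  congr (W _ * _); first exact: face5.
  by rewrite -(kernel_period 0) kernel_turn.
by apply: eq_bigr => i _ /=; rewrite /bump /= add1n -iterSr kernel_turn.
Qed.

Lemma kernelE z : gap q 0 z = 0 ->
  [/\ side_kernel 0 z = phi 0 (gap q 1 z) (gap q 2 z) (gap q 3 z) (gap q 4 z),
      side_kernel 1 z = phi (gap q 1 z) (gap q 2 z) (gap q 3 z) (gap q 4 z) 0,
      side_kernel 2 z = phi (gap q 2 z) (gap q 3 z) (gap q 4 z) 0 (gap q 1 z),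
      side_kernel 3 z = phi (gap q 3 z) (gap q 4 z) 0 (gap q 1 z) (gap q 2 z) &
      side_kernel 4 z = phi (gap q 4 z) 0 (gap q 1 z) (gap q 2 z) (gap q 3 z)].
Proof.
have g5 : gap q 5 z = gap q 0 z := gap_period q 0 z.
have g6 : gap q 6 z = gap q 1 z := gap_period q 1 z.
have g7 : gap q 7 z = gap q 2 z := gap_period q 2 z.
have g8 : gap q 8 z = gap q 3 z := gap_period q 3 z.
by move=> g0; rewrite /side_kernel g5 g6 g7 g8 g0.
Qed.

(** The invariance needed across an edge: the five side distances of a point of the
    base side are 0, a1, a2, a3, a4, and those of its partner 0, a4, a3, a2, a1. *)
Definition crossing_invariant (W : D -> R) := forall d a1 a2 a3 a4,
  let s e a1 a2 a3 a4 :=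
    W e * phi 0 a1 a2 a3 a4 + W (iter 1 face e) * phi a1 a2 a3 a4 0 +
    W (iter 2 face e) * phi a2 a3 a4 0 a1 + W (iter 3 face e) * phi a3 a4 0 a1 a2 +
    W (iter 4 face e) * phi a4 0 a1 a2 a3 in
  s d a1 a2 a3 a4 = s (edge d) a4 a3 a2 a1.

Lemma wsum5 W d z : wsum W (d, z) =
  W d * side_kernel 0 z + W (iter 1 face d) * side_kernel 1 z +
  W (iter 2 face d) * side_kernel 2 z + W (iter 3 face d) * side_kernel 3 z +
  W (iter 4 face d) * side_kernel 4 z.
Proof. by rewrite /wsum !big_ord_recl big_ord0 /= addr0 !addrA. Qed.

Lemma wsum_cross W d z : crossing_invariant W -> base_side 5 q z ->
  wsum W (d, z) = wsum W (edge d, cross q z).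
Proof.
move=> cW /base_sideP[_ g0]; have [h0 h1 h2 h3 h4] := gap_cross g0.
rewrite !wsum5.
have [-> -> -> -> ->] := kernelE g0; have [-> -> -> -> ->] := kernelE h0.
by rewrite h1 h2 h3 h4; exact: cW.
Qed.

Lemma wsum_glued W x y : crossing_invariant W -> glue x y -> wsum W x = wsum W y.
Proof.
move=> cW; elim=> [_ _ [d z _|d z hz]| | ? ? _ ->| ? ? ? _ -> _ ->] //.
  exact: wsum_turn.
exact: wsum_cross.
Qed.

Hypothesis phi_continuous : forall k, continuous (side_kernel k).

Lemma wsum_continuous W d : continuous (fun z => wsum W (d, z)).
Proof.
have cM c k z : W c * side_kernel k y @[y --> z] --> W c * side_kernel k z.
  by apply: cvgM; [exact: cvg_cst | exact: phi_continuous].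
by move=> z; rewrite (funext (wsum5 W d)); do 4?apply: cvgD; exact: cM.
Qed.

End Kernel.

Definition invariant (f : D * (R * R) -> R) :=
  (forall x y, glue x y -> f x = f y) /\ forall d, continuous (fun z => f (d, z)).

Lemma wsum_invariant phi W : (forall k, continuous (side_kernel phi k)) ->
  crossing_invariant phi W -> invariant (wsum phi W).
Proof. by move=> cphi cW; split=> [x y|d]; [exact: wsum_glued|exact: wsum_continuous]. Qed.

Lemma wsum_delta phi d z j : (j < 5)%N ->
  wsum phi (fun e => (e == iter j face d)%:R) (d, z) = side_kernel phi j z.
Proof.
move=> j5; rewrite /wsum (bigD1 (Ordinal j5)) //= eqxx mul1r big1 ?addr0 // => i ij.
case: eqP => [/esym e|_]; rewrite ?mul0r //; case/negP: ij; apply/eqP/val_inj => /=.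
have inj n : injective (iter n face) by elim: n => //= n IH x y /perm_inj/IH.
have i5 := ltn_ord i.
case: (leqP i j) => [|/ltnW] ij; rewrite -(subnKC ij) iterD in e.
- move/inj/face_free: e; rewrite (leq_ltn_trans (leq_subr _ _)) // => /(_ isT)/eqP.
  by rewrite subn_eq0 => ji; apply/eqP; rewrite eqn_leq ij.
- move/inj/esym/face_free: e; rewrite (leq_ltn_trans (leq_subr _ _)) // => /(_ isT)/eqP.
  by rewrite subn_eq0 => ji; apply/eqP; rewrite eqn_leq ij andbT.
Qed.

Lemma wsum_delta_neq0 phi d e w : wsum phi (fun e => (e == d)%:R) (e, w) != 0 ->
  exists2 k, iter k face e = d & side_kernel phi k w != 0.
Proof.
move=> h; suff [k /eqP e1 e2] : exists2 k : 'I_5, iter k face e == d & side_kernel phi k w != 0.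
  by exists k.
apply/exists_inP; apply: contraNT h => /exists_inPn h; rewrite /wsum big1 // => k _ /=.
case: eqP => [ek|]; last by rewrite mul0r.
by rewrite (eqP (negbNE (h k _))) ?mulr0 // ; apply/eqP.
Qed.

Definition inside (z : R * R) := forall k, 0 < gap q k z.
Definition mid_side (z : R * R) := gap q 0 z = 0 /\ forall k, (0 < k < 5)%N -> 0 < gap q k z.

(** A turn brings a boundary point to the base side, and another one brings the far
    end of that side to corner 0. *)
Lemma settle d z : polygon 5 q z ->
  exists e w, glue (d, z) (e, w) /\ [\/ inside w, mid_side w | w = c0].
Proof.
move=> hz; case: (pselect (inside z)) => [iz|/existsNP[k hk]].
  by exists d, z; split; [exact: glued_refl | constructor 1].
have gk : gap q k z = 0.
  apply/eqP; rewrite eq_le leNgt; apply/andP; split; first exact/negP.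
  exact: (polygonP q z).1 hz _.
have hw := polygon_iter_back k hz.
have [gl b] : glue (d, z) (iter k face d, iter k back z) /\ base_side 5 q (iter k back z).
  by split; [exact: glued_iter_back | apply/base_sideP; rewrite gap_iter_back addn0].
move: gl b hw; move: (iter k face d) (iter k back z) => e w gl b hw.
have [g2 g3] := base_side_gap23 rho_gt0 b.
have [_ g0] := (base_sideP q w).1 b; have hg := (polygonP q w).1 hw.
have [g4|g4] := eqVneq (gap q 4 w) 0.
  by exists e, w; split=> //; constructor 3; exact: gap4_eq0.
have [g1|g1] := eqVneq (gap q 1 w) 0; last first.
  exists e, w; split=> //; constructor 2; split=> //.
  by move=> [|[|[|[|[|//]]]]] // _; rewrite ?lt_def ?g1 ?g4 ?hg.
have wc : w = c1 by exact: gap1_eq0.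
exists (face e), c0; split; last by constructor 3.
apply: glued_trans gl _; rewrite wc corner1E; apply: glued_sym; apply: glued_turn.
by case: (base_side_corner0 rho_gt0).
Qed.

(** The kernels are products of side distances. [phi_inside] vanishes on the whole
    boundary, and [phi_locate] has the distance to the side as a further factor.
    [phi_side] vanishes on all sides but its own, where [phi_along] adds an
    odd coordinate. [phi_corner] is positive, among the corners, only at the
    starting corner of its side. *)
Definition phi_inside (x0 x1 x2 x3 x4 : R) := x0 * x1 * x2 * x3 * x4.
Definition phi_locate (x0 x1 x2 x3 x4 : R) := x0 * x1 * x2 * x3 * x4 * x0.
Definition phi_side (x0 x1 x2 x3 x4 : R) := x1 * x2 * x3 * x4.
Definition phi_along (x0 x1 x2 x3 x4 : R) := x1 * x2 * x3 * x4 * (x1 - x4).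
Definition phi_corner (x0 x1 x2 x3 x4 : R) := x1 * x2 * x3.

Let cgap k (z : R * R) : gap q k y @[y --> z] --> gap q k z. Proof. exact: gap_continuous. Qed.

Lemma inside_invariant W : invariant (wsum phi_inside W).
Proof.
apply: wsum_invariant; last by move=> d a1 a2 a3 a4 /=; rewrite /phi_inside; ring.
by move=> k z; rewrite /side_kernel /phi_inside; do ?apply: cvgM; exact: cgap.
Qed.

Lemma locate_invariant W : invariant (wsum phi_locate W).
Proof.
apply: wsum_invariant; last by move=> d a1 a2 a3 a4 /=; rewrite /phi_locate; ring.
by move=> k z; rewrite /side_kernel /phi_locate; do ?apply: cvgM; exact: cgap.
Qed.

Lemma side_invariant (W : D -> R) : (forall d, W (edge d) = W d) -> invariant (wsum phi_side W).
Proof.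
move=> eW; apply: wsum_invariant.
  by move=> k z; rewrite /side_kernel /phi_side; do ?apply: cvgM; exact: cgap.
by move=> d a1 a2 a3 a4 /=; rewrite eW /phi_side; ring.
Qed.

Lemma along_invariant (W : D -> R) : (forall d, W (edge d) = - W d) ->
  invariant (wsum phi_along W).
Proof.
move=> eW; apply: wsum_invariant.
  move=> k z; rewrite /side_kernel /phi_along; apply: cvgM; first by do ?apply: cvgM; exact: cgap.
  by apply: cvgB; exact: cgap.
by move=> d a1 a2 a3 a4 /=; rewrite eW /phi_along; ring.
Qed.

(** On the base side only the kernels of its two ends survive; [node] identifies
    the start of [d] with the end of [edge d], and conversely. *)
Lemma corner_invariant (W : D -> R) : (forall d, W (node d) = W d) ->
  invariant (wsum phi_corner W).
Proof.
move=> nW; apply: wsum_invariant.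
  by move=> k z; rewrite /side_kernel /phi_corner; do ?apply: cvgM; exact: cgap.
move=> d a1 a2 a3 a4 /=.
have -> : W (face (edge d)) = W d by rewrite -(nW d) permM.
have -> : W (edge d) = W (face d) by rewrite -(nW (edge d)) permM edgeK.
by rewrite /phi_corner; ring.
Qed.

Lemma kernel_inside_gt0 z : inside z -> forall k, 0 < side_kernel phi_inside k z.
Proof. by move=> iz k; rewrite /side_kernel /phi_inside !mulr_gt0. Qed.

Lemma wsum_mid_side phi W d z : mid_side z ->
  (forall a1 a2 a3 a4, [/\ phi a1 a2 a3 a4 0 = 0, phi a2 a3 a4 0 a1 = 0,
    phi a3 a4 0 a1 a2 = 0 & phi a4 0 a1 a2 a3 = 0]) ->
  wsum phi W (d, z) = W d * side_kernel phi 0 z.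
Proof.
move=> [g0 _] h; rewrite wsum5.
have [_ -> -> -> ->] := kernelE phi g0.
have [-> _ _ _] := h (gap q 1 z) (gap q 2 z) (gap q 3 z) (gap q 4 z).
have [_ -> _ _] := h (gap q 1 z) (gap q 2 z) (gap q 3 z) (gap q 4 z).
have [_ _ -> _] := h (gap q 1 z) (gap q 2 z) (gap q 3 z) (gap q 4 z).
have [_ _ _ ->] := h (gap q 1 z) (gap q 2 z) (gap q 3 z) (gap q 4 z).
by rewrite !mulr0 !addr0.
Qed.

Lemma wsum_side_mid W d z : mid_side z -> wsum phi_side W (d, z) = W d * side_kernel phi_side 0 z.
Proof.
by move=> hz; apply: wsum_mid_side => // *; rewrite /phi_side !(mulr0, mul0r).
Qed.

Lemma wsum_along_mid W d z : mid_side z ->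
  wsum phi_along W (d, z) = W d * side_kernel phi_along 0 z.
Proof.
by move=> hz; apply: wsum_mid_side => // *; rewrite /phi_along !(mulr0, mul0r).
Qed.

Lemma kernel_side_gt0 z : mid_side z -> 0 < side_kernel phi_side 0 z.
Proof. by move=> [g0 h]; rewrite /side_kernel /phi_side !mulr_gt0 ?h. Qed.

Lemma wsum_side_corner W d : wsum phi_side W (d, c0) = 0.
Proof.
have [g0 _ _ _ g4] := gap_corner0 rho_gt0.
rewrite wsum5; have [-> -> -> -> ->] := kernelE phi_side g0.
by rewrite /phi_side g4 !(mulr0, mul0r) !addr0.
Qed.

Lemma wsum_corner_corner W d :
  wsum phi_corner W (d, c0) = W d * (gap q 1 c0 * gap q 2 c0 * gap q 3 c0).
Proof.
have [g0 _ _ _ g4] := gap_corner0 rho_gt0.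
rewrite wsum5; have [-> -> -> -> ->] := kernelE phi_corner g0.
by rewrite /phi_corner g4 !(mulr0, mul0r) !addr0.
Qed.

Definition side_weight (d e : D) : R := ((e == d) || (e == edge d))%:R.

Lemma side_weight_edge d e : side_weight d (edge e) = side_weight d e.
Proof.
rewrite /side_weight (inj_eq perm_inj) orbC; congr ((_ || _)%:R).
by apply/eqP/eqP => [<-|->]; rewrite edgeK.
Qed.

Definition along_weight (d e : D) : R := (e == d)%:R - (e == edge d)%:R.

Lemma along_weight_edge d e : along_weight d (edge e) = - along_weight d e.
Proof.
rewrite /along_weight (inj_eq perm_inj) opprB; congr (_ - _%:R).
by congr (nat_of_bool _)%:R; apply/eqP/eqP => [<-|->]; rewrite edgeK.
Qed.

Definition node_weight (d e : D) : R := (e \in porbit node d)%:R.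

Lemma node_weight_node d e : node_weight d (node e) = node_weight d e.
Proof.
have := porbit_perm node 1 e; rewrite expg1 => h.
by rewrite /node_weight porbit_sym h porbit_sym.
Qed.

Definition agree (x y : D * (R * R)) := forall f, invariant f -> f x = f y.

Lemma agree_glued x y x' y' : glue x x' -> glue y y' -> agree x y -> agree x' y'.
Proof.
by move=> gx gy h f inv; have [gf _] := inv; rewrite -(gf _ _ gx) -(gf _ _ gy); exact: h.
Qed.

Lemma agree_sym x y : agree x y -> agree y x.
Proof. by move=> h f /h. Qed.

Lemma glued_agree x y : glue x y -> agree x y.
Proof. by move=> gl f [gf _]; exact: gf. Qed.

(** The kernel of [d] alone vanishes inside all other tiles. *)
Lemma agree_inside d z e w : inside z -> agree (d, z) (e, w) ->
  exists k, iter k face e = d.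
Proof.
move=> iz h; suff [k ek _] : exists2 k, iter k face e = d & side_kernel phi_inside k w != 0.
  by exists k.
apply: wsum_delta_neq0; rewrite -(h _ (inside_invariant _)).
by rewrite (wsum_delta _ _ _ (isT : (0 < 5)%N)) gt_eqF // kernel_inside_gt0.
Qed.

(** The kernels of [d] and of its partner vanish inside all other sides. *)
Lemma agree_mid_side d z e w : mid_side z -> mid_side w -> agree (d, z) (e, w) ->
  e = d \/ e = edge d.
Proof.
move=> hz hw h; have := h _ (side_invariant (side_weight_edge d)).
rewrite !wsum_side_mid // /side_weight eqxx mul1r => e0.
have : ((e == d) || (e == edge d))%:R != 0 :> R.
  by apply: contraTneq (kernel_side_gt0 hz) => e1; rewrite e0 e1 mul0r ltxx.
by rewrite pnatr_eq0 eqb0 negbK => /orP[]/eqP; [left|right].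
Qed.

Lemma separate_inside d z e w : polygon 5 q z -> polygon 5 q w -> inside z ->
  agree (d, z) (e, w) -> glue (d, z) (e, w).
Proof.
move=> hz hw iz h.
have uz := kernel_inside_gt0 iz.
have [k ek] := agree_inside iz h.
have gl := glued_iter_back k e hw; rewrite ek in gl.
apply: glued_trans (glued_sym gl).
have {}h := agree_glued (glued_refl _) gl h.
have -> // : iter k back w = z; last exact: glued_refl.
have e0 := h _ (inside_invariant (fun e => (e == iter 0 face d)%:R)).
have l0 := h _ (locate_invariant (fun e => (e == iter 0 face d)%:R)).
have e1 := h _ (inside_invariant (fun e => (e == iter 1 face d)%:R)).
have l1 := h _ (locate_invariant (fun e => (e == iter 1 face d)%:R)).
rewrite !wsum_delta // in e0 l0 e1 l1.
apply: (@gap_inj _ q); apply/esym.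
  by apply: (mulfI (lt0r_neq0 (uz 0%N))); rewrite [in RHS]e0; exact: l0.
by apply: (mulfI (lt0r_neq0 (uz 1%N))); rewrite [in RHS]e1; exact: l1.
Qed.

Lemma separate_mid_side d z e w : mid_side z -> mid_side w ->
  agree (d, z) (e, w) -> glue (d, z) (e, w).
Proof.
move=> hz hw.
have mid_base v : mid_side v -> base_side 5 q v.
  move=> [g0 h]; apply/base_sideP; split=> //; apply/polygonP => k; rewrite -gap_mod.
  have : (k %% 5 < 5)%N by rewrite ltn_mod.
  by case: (k %% 5)%N => [|j] j5; [rewrite g0 | rewrite ltW // h].
have mid_cross v : mid_side v -> mid_side (cross q v).
  move=> [g0 h]; have [h0 h1 h2 h3 h4] := gap_cross g0; split=> //.
  by move=> [|[|[|[|[|k]]]]] // _; rewrite ?h1 ?h2 ?h3 ?h4 h.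
have main v : mid_side v -> agree (d, z) (d, v) -> glue (d, z) (d, v).
  move=> hv h; have -> : v = z; last exact: glued_refl.
  have e0 := h _ (side_invariant (side_weight_edge d)).
  have l0 := h _ (along_invariant (along_weight_edge d)).
  rewrite !wsum_side_mid // /side_weight eqxx !mul1r in e0.
  rewrite !wsum_along_mid // /along_weight eqxx eq_sym (negbTE (edge_neq d)) subr0 !mul1r in l0.
  apply: (@gap14_inj _ q); first by rewrite (proj1 hv) (proj1 hz).
  apply: (mulfI (lt0r_neq0 (kernel_side_gt0 hz))); rewrite [in LHS]e0; apply/esym.
  exact: l0.
move=> h; have [ee|ee] := agree_mid_side hz hw h; first by rewrite ee in h *; exact: main.
have gl : glue (e, w) (d, cross q w) by rewrite -[d]edgeK -ee; apply/glued_cross/mid_base.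
apply: glued_trans (glued_sym gl); apply: main; first exact: mid_cross.
exact: agree_glued (glued_refl _) gl h.
Qed.

Lemma separate_corner d e : agree (d, c0) (e, c0) -> glue (d, c0) (e, c0).
Proof.
move=> /(_ _ (corner_invariant (node_weight_node d))); rewrite !wsum_corner_corner.
have [_ g1 g2 g3 _] := gap_corner0 rho_gt0; rewrite /node_weight porbit_id mul1r => h.
apply: glued_node_orbit; apply: contraT => /negbTE ne; move: h; rewrite ne mul0r => h.
by have := mulr_gt0 (mulr_gt0 g1 g2) g3; rewrite h ltxx.
Qed.

Lemma mid_side_corner d z e : mid_side z -> ~ agree (d, z) (e, c0).
Proof.
move=> hz /(_ _ (side_invariant (side_weight_edge d))).
rewrite wsum_side_mid // wsum_side_corner /side_weight eqxx mul1r => h.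
by have := kernel_side_gt0 hz; rewrite h ltxx.
Qed.

(** Once both points are in standard position, the three kinds of points differ in
    which of the functions vanish, and within one kind the remaining functions give
    the coordinates of the point. *)
Lemma separate d z e w : polygon 5 q z -> polygon 5 q w ->
  agree (d, z) (e, w) -> glue (d, z) (e, w).
Proof.
move=> hz hw h.
have [d' [z' [glz sz]]] := settle d hz; have [e' [w' [glw sw]]] := settle e hw.
apply: (glued_trans glz); apply: glued_trans (glued_sym glw).
have {}h := agree_glued glz glw h.
have {}hz : polygon 5 q z' by exact: (glued_polygon glz).1 hz.
have {}hw : polygon 5 q w' by exact: (glued_polygon glw).1 hw.
case: sz sw h => [iz _ h|iz|zc].
- exact: separate_inside.
- case=> [iw h|iw h|-> h].
  + by apply: glued_sym; apply: separate_inside => //; exact: agree_sym.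
  + exact: separate_mid_side.
  + by case: (mid_side_corner iz h).
- rewrite {}zc in hz glz *; case=> [iw h|iw h|-> h].
  + by apply: glued_sym; apply: separate_inside => //; exact: agree_sym.
  + by case: (mid_side_corner iw (agree_sym h)).
  + exact: separate_corner.
Qed.

End Gluing.

(** * The glued surface *)

Section Surface.
Local Open Scope classical_set_scope.
Local Open Scope ring_scope.
Local Open Scope quotient_scope.
Context (R : realType).
Variables (q : nat) (D : finType) (face edge : {perm D}).
Implicit Types z : R * R.

(** The quotient is taken on all pairs of a dart and a vector, those outside the
    polygon being identified with the centre of the tile. *)
Definition clamp z : R * R := if `[< polygon 5 q z >] then z else 0.

Definition same_place (x y : D * (R * R)) : bool :=
  `[< glued 5 q face edge (x.1, clamp x.2) (y.1, clamp y.2) >].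

Lemma same_place_equiv : equiv_class_of same_place.
Proof.
split.
- by move=> x; apply/asboolP; exact: glued_refl.
- by move=> x y; apply/asboolP/asboolP; exact: glued_sym.
- move=> y x z /asboolP h /asboolP h'; apply/asboolP; exact: glued_trans h h'.
Qed.

Canonical same_place_equiv_rel := EquivRelPack same_place_equiv.

Definition surface := {eq_quot same_place_equiv_rel}.
HB.instance Definition _ := Choice.on surface.

Definition chart (d : D) z : surface := \pi_({eq_quot same_place_equiv_rel}) (d, z).

(** The final topology of the charts, expressed by neighbourhoods so that unions
    raise no choice of open sets. *)
Definition surface_open (A : set surface) := forall d z, polygon 5 q z ->
  A (chart d z) -> \forall w \near z, polygon 5 q w -> A (chart d w).

Lemma surface_openT : surface_open setT.
Proof. by move=> d z _ _; near=> w. Unshelve. all: by end_near. Qed.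

Lemma surface_openI : setI_closed surface_open.
Proof.
move=> A B oA oB d z hz [Az Bz]; near=> w => hw; split.
  by move: hw; near: w; exact: oA.
by move: hw; near: w; exact: oB.
Unshelve. all: by end_near. Qed.

Lemma surface_open_bigU (I : Type) (A : I -> set surface) :
  (forall i, surface_open (A i)) -> surface_open (\bigcup_i A i).
Proof.
move=> oA d z hz [i _ Az]; near=> w => hw; exists i => //.
by move: hw; near: w; exact: oA.
Unshelve. all: by end_near. Qed.

HB.instance Definition _ := isOpenTopological.Build surface
  surface_openT surface_openI surface_open_bigU.

Lemma surface_openP (A : set surface) : open A <-> surface_open A.
Proof. by []. Qed.

Lemma clamp_in z : polygon 5 q z -> clamp z = z.
Proof. by move=> hz; rewrite /clamp; case: asboolP. Qed.

Lemma chart_eq d e z w : polygon 5 q z -> polygon 5 q w ->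
  chart d z = chart e w <-> glued 5 q face edge (d, z) (e, w).
Proof.
move=> hz hw; rewrite /chart; split=> [/eqP|h].
  by rewrite eqmodE => /asboolP; rewrite /= !clamp_in.
by apply/eqP; rewrite eqmodE; apply/asboolP; rewrite /= !clamp_in.
Qed.

Lemma chart_continuous d : {within polygon 5 q, continuous (chart d)}.
Proof.
apply/subspace_continuousP => z hz A /=; rewrite nbhsE /= => -[B [oB Bz] BA].
have h := (surface_openP B).1 oB d z hz Bz.
by rewrite /nbhs /= /within /=; apply: filterS h => w h pw; exact: BA (h pw).
Qed.

Hypothesis q4 : (4 < q)%N.

Lemma clamp_polygon z : polygon 5 q (clamp z).
Proof.
rewrite /clamp; case: asboolP => // _.
exact: origin_polygon (circumradius_gt0 R q4).
Qed.

Let Q := {eq_quot same_place_equiv_rel}.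
Definition representative (x : surface) : D * (R * R) :=
  generic_quotient.repr (x : Q).

Lemma chart_representative x :
  chart (representative x).1 (clamp (representative x).2) = x.
Proof.
rewrite -[RHS](@generic_quotient.reprK _ Q) /chart; apply/eqP; rewrite eqmodE.
apply/asboolP; rewrite /= clamp_in; [exact: glued_refl | exact: clamp_polygon].
Qed.

Lemma chart_surj (x : surface) : exists d, exists2 z, polygon 5 q z & chart d z = x.
Proof.
exists (representative x).1, (clamp (representative x).2); first exact: clamp_polygon.
exact: chart_representative.
Qed.

Section Descent.
Variables (T : Type) (f : D * (R * R) -> T).
Hypothesis f_glued : forall d z e w, polygon 5 q z -> polygon 5 q w ->
  glued 5 q face edge (d, z) (e, w) -> f (d, z) = f (e, w).

Definition descend (x : surface) : T :=
  f ((representative x).1, clamp (representative x).2).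

Lemma descend_chart d z : polygon 5 q z -> descend (chart d z) = f (d, z).
Proof.
move=> hz; apply: f_glued => //; first exact: clamp_polygon.
by apply/chart_eq; rewrite ?chart_representative //; exact: clamp_polygon.
Qed.
End Descent.

Lemma descend_continuous (T : topologicalType) (f : D * (R * R) -> T) :
  (forall d z e w, polygon 5 q z -> polygon 5 q w ->
    glued 5 q face edge (d, z) (e, w) -> f (d, z) = f (e, w)) ->
  (forall d, {within polygon 5 q, continuous (fun z => f (d, z))}) ->
  continuous (descend f).
Proof.
move=> gf cf; apply/continuousP => A oA; apply/surface_openP => d z hz /=.
rewrite descend_chart // => Az.
have := (subspace_continuousP _ _).1 (cf d) z hz A (open_nbhs_nbhs (conj oA Az)).
rewrite /nbhs /= /within /=; apply: filterS => w h hw.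
by rewrite /= descend_chart //; exact: h.
Qed.

Lemma surface_compact : compact [set: surface].
Proof.
have -> : [set: surface] = \bigcup_(d in [set` enum D]) (chart d @` polygon 5 q).
  apply/seteqP; split=> // x _; have [d [z hz <-]] := chart_surj x.
  by exists d; [rewrite /= mem_enum | exists z].
rewrite bigcup_seq; apply: bigsetU_compact => d _.
apply: continuous_compact; first exact: chart_continuous.
exact: (@polygon_compact R q).
Qed.

(** Distinct points differ under an invariant function, which is continuous on the
    surface. *)
Lemma surface_hausdorff :
  (forall d, edge (edge d) = d) -> (forall d, edge d != d) ->
  (forall d, iter 5 face d = d) ->
  (forall d k, (k < 5)%N -> iter k face d = d -> k = 0) ->
  hausdorff_space surface.
Proof.
move=> edgeK edge_neq face5 face_free.
rewrite open_hausdorff => x y; have [d [z hz <-]] := chart_surj x.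
have [e [w hw <-]] := chart_surj y => ne.
have [f [[gf cf] nf]] : exists f, @invariant R q D face edge f /\ f (d, z) <> f (e, w).
  apply: contrapT => h; move/eqP: ne; apply; apply/(chart_eq d e hz hw).
  apply: (separate q4) => // f inv; apply: contrapT => nf; apply: h; by exists f.
have gf' d1 z1 e1 w1 : polygon 5 q z1 -> polygon 5 q w1 ->
    glued 5 q face edge (d1, z1) (e1, w1) -> f (d1, z1) = f (e1, w1) by move=> _ _; exact: gf.
have cl : continuous (descend f).
  by apply: descend_continuous => // d1; apply: continuous_subspaceT; exact: cf.
have := @Rhausdorff R; rewrite open_hausdorff => /(_ (f (d, z)) (f (e, w))).
case; first exact/eqP.
move=> [U V] /= [/set_mem zU /set_mem wV] [oU oV UV].
exists (descend f @^-1` U, descend f @^-1` V) => /=.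
  by split; apply/mem_set; rewrite /= descend_chart.
move/continuousP in cl; split; [exact: cl | exact: cl |].
by rewrite -preimage_setI; apply/eqP; rewrite (eqP UV) preimage_set0.
Qed.

End Surface.

(** * Double covers from involutions *)

Section InvolutionCover.
Local Open Scope classical_set_scope.
Local Open Scope ring_scope.

(** As a map from a compact to a Hausdorff space, [f] is closed. It is also open:
    the points over the image of [W] are those of [W] and of its translate by [s],
    so the complement of that image is the image of a closed set. A point that [s]
    moves has a neighbourhood disjoint from its translate, and the image of this
    neighbourhood is evenly covered. *)
Lemma involution_double_cover (X Y : topologicalType) (f : X -> Y) (s : X -> X)
    (V : set Y) :
  compact [set: X] -> hausdorff_space X -> hausdorff_space Y ->
  continuous f -> continuous s -> involutive s -> (forall y, exists x, f x = y) ->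
  (forall x x', f x = f x' <-> x' = x \/ x' = s x) ->
  (forall x, s x = x <-> V (f x)) ->
  double_cover_branched_over f V.
Proof.
move=> cX hX hY cf cs sK sf fib fix_s.
have fs x : f (s x) = f x by apply/esym/fib; right.
have f_open W : open W -> open (f @` W).
  move=> oW; rewrite -[f @` W]setCK; apply/closed_openC.
  have -> : ~` (f @` W) = f @` (~` (W `|` s @^-1` W)).
    apply/seteqP; split=> [y ny|_ [x nx <-] [x' Wx' e]].
      have [x xy] := sf y; exists x => // -[Wx|Wsx]; apply: ny; [by exists x|].
      by exists (s x); rewrite // fs.
    have [e'|e'] := (fib _ _).1 e; apply: nx; rewrite e'; [by left|right].
    by rewrite /= sK.
  have cW : closed (~` (W `|` s @^-1` W)).
    by apply/open_closedC/openU => //; move/continuousP: cs; exact.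
  apply: compact_closed => //; apply: continuous_compact.
    exact: continuous_subspaceT.
  by apply: (subclosed_compact cW cX) => x _.
split=> // [y Vy|y nVy].
  have [x xy] := sf y; exists x; split=> // x' x'y.
  have sx : s x = x by apply/fix_s; rewrite xy.
  have : f x = f x' by rewrite xy x'y.
  by case/fib=> ->; rewrite ?sx.
have [x xy] := sf y.
have nsx : x != s x by apply/eqP => /esym/fix_s; rewrite xy.
have := hX; rewrite open_hausdorff => /(_ _ _ nsx)[[A B]] /= [/set_mem Ax /set_mem Bsx].
move=> [oA oB AB].
have os O : open O -> open (s @^-1` O) by move/continuousP: cs; exact.
pose U1 := A `&` s @^-1` B; pose U2 := s @^-1` U1.
have oU1 : open U1 by apply: openI => //; exact: os.
have oU2 : open U2 by exact: os.
have dis : U1 `&` U2 = set0.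
  rewrite -subset0 => z [[Az _] [_ Bz]]; rewrite /= sK in Bz.
  by have : (A `&` B) z by []; rewrite (eqP AB).
have bij U : open U -> (forall z, U z -> ~ U (s z)) -> set_bij U (f @` U) f.
  move=> oU nU; split=> //.
  move=> z w /set_mem Uz /set_mem Uw /fib[//|wz].
  by case: (nU z Uz); rewrite -wz.
exists (f @` U1), U1, U2; split=> //.
- by split; [exact: f_open | exists x].
- split=> //; apply/seteqP; split=> z /=.
    by move=> [w U1w /fib[->|->]]; [left | right; rewrite /U2 /= sK].
  by move=> [U1z|U2z]; [exists z | exists (s z); rewrite ?fs].
- have d1 z : U1 z -> ~ U1 (s z).
    by move=> h h'; have : (U1 `&` U2) z by []; rewrite dis.
  split; first exact: bij.
  have -> : f @` U1 = f @` U2.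
    apply/seteqP; split=> _ [z Uz <-].
      by exists (s z); rewrite ?fs // /U2 /= sK.
    by exists (s z); rewrite ?fs.
  by apply: bij => // z Uz; rewrite /U2 /= sK => h; exact: d1 h Uz.
- by move=> W oW _; exact: f_open.
Qed.

End InvolutionCover.

(** * The two-sheeted cover of a map of type {5,5} *)

Section Double.
Local Open Scope classical_set_scope.
Local Open Scope ring_scope.
Variables (D : finType) (face edge : {perm D}).

Lemma double_face_inj : injective (fun x : D * bool => (face x.1, x.2)).
Proof. by move=> [d b] [e c] [/perm_inj-> ->]. Qed.
Lemma double_edge_inj : injective (fun x : D * bool => (edge x.1, ~~ x.2)).
Proof. by move=> [d b] [e c] [/perm_inj-> /negb_inj->]. Qed.

Definition double_face : {perm D * bool} := perm double_face_inj.

(** Crossing an edge changes the sheet, so turning once around a vertex of odd degree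
    does. *)
Definition double_edge : {perm D * bool} := perm double_edge_inj.
Local Notation node := (edge * face)%g.
Local Notation double_node := (double_edge * double_face)%g.

Lemma double_faceE d b : double_face (d, b) = (face d, b). Proof. by rewrite permE. Qed.
Lemma double_edgeE d b : double_edge (d, b) = (edge d, ~~ b). Proof. by rewrite permE. Qed.
Lemma double_nodeE d b : double_node (d, b) = (node d, ~~ b).
Proof. by rewrite !permM double_edgeE double_faceE. Qed.

Lemma iter_double_face n d b : iter n double_face (d, b) = (iter n face d, b).
Proof. by elim: n => //= n ->; rewrite double_faceE. Qed.
Lemma iter_double_node n d b : iter n double_node (d, b) = (iter n node d, odd n (+) b).
Proof. by elim: n => //= n ->; rewrite double_nodeE addNb. Qed.

Hypothesis edgeK : forall d, edge (edge d) = d.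
Hypothesis edge_neq : forall d, edge d != d.
Hypothesis face5 : forall d, iter 5 face d = d.
Hypothesis node5 : forall d, iter 5 node d = d.
Hypothesis face_free : forall d k, (k < 5)%N -> iter k face d = d -> k = 0.

Lemma double_edgeK x : double_edge (double_edge x) = x.
Proof. by case: x => d b; rewrite !double_edgeE edgeK negbK. Qed.
Lemma double_edge_neq x : double_edge x != x.
Proof. by case: x => d b; rewrite double_edgeE xpair_eqE (negbTE (edge_neq d)). Qed.
Lemma double_face5 x : iter 5 double_face x = x.
Proof. by case: x => d b; rewrite iter_double_face face5. Qed.
Lemma double_face_free x k : (k < 5)%N -> iter k double_face x = x -> k = 0.
Proof. by case: x => d b k5; rewrite iter_double_face => -[/(face_free k5)]. Qed.

Lemma double_node_orbit d b c : (d, c) \in porbit double_node (d, b).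
Proof.
case: (eqVneq c b) => [->|cb]; first exact: porbit_id.
have -> : (d, c) = iter 5 double_node (d, b).
  by rewrite iter_double_node node5; case: b c cb => -[].
by rewrite -permX; exact: mem_porbit.
Qed.

Section Cover.
Context (R : realType) (Y : topologicalType) (T : tiling R 5 5 Y).
Variables (h : D -> tdart T) (g : tdart T -> D).
Hypotheses (hK : cancel h g) (gK : cancel g h).
Hypothesis h_face : forall d, h (face d) = tface T (h d).
Hypothesis h_edge : forall d, h (edge d) = tedge T (h d).

Local Notation X := (surface R 10 double_face double_edge).
Local Notation up := (@rescale R 10 5).
Local Notation down := (@rescale R 5 10).
Local Notation glueX := (@glued R 5 10 _ double_face double_edge).
Local Notation glueT := (@glued R 5 5 _ (tface T) (tedge T)).
Local Notation chartX := (@chart R 10 _ double_face double_edge).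
Local Notation c0 := (corner R 5 10 0).

Let upK : cancel up down. Proof. exact: rescaleK. Qed.
Let downK : cancel down up. Proof. exact: rescaleK. Qed.

Let g_face d : g (tface T d) = face (g d).
Proof. by rewrite -{1}[d]gK -h_face hK. Qed.
Let g_edge d : g (tedge T d) = edge (g d).
Proof. by rewrite -{1}[d]gK -h_edge hK. Qed.

Lemma glued_down x y : glueX x y -> glueT (h x.1.1, up x.2) (h y.1.1, up y.2).
Proof.
elim=> [_ _ [[d b] z hz|[d b] z hz]|?|? ? _|? ? ? _ + _] /=.
- by rewrite double_faceE /= h_face rescale_turn; apply/glued_turn/polygon_rescale.
- rewrite double_edgeE /= h_edge -/(cross 10 z) rescale_cross //.
  by apply: glued_cross; apply/base_side_rescale.
- exact: glued_refl.
- exact: glued_sym.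
- exact: glued_trans.
Qed.

(** Lifting of chains of gluings: whether the sheet changes along the chain does not
    depend on the sheet where the lift starts. *)
Lemma glued_up x y : glueT x y -> exists c, forall b,
  glueX ((g x.1, b), down x.2) ((g y.1, b (+) c), down y.2).
Proof.
elim=> [_ _ [d z hz|d z hz]|?|? ? _ [c IH]|? ? ? _ [c IH] _ [c' IH']] /=.
- exists false => b; rewrite addbF rescale_turn g_face -double_faceE.
  by apply: glued_turn; apply/polygon_rescale.
- exists true => b; rewrite addbT -/(cross 5 z) rescale_cross // g_edge -double_edgeE.
  by apply: glued_cross; apply/base_side_rescale.
- by exists false => b; rewrite addbF; exact: glued_refl.
- by exists c => b; apply: glued_sym; have := IH (b (+) c); rewrite addbK.
- by exists (c (+) c') => b; apply: glued_trans (IH b) _; rewrite addbA; exact: IH'.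
Qed.

Lemma glued_flip x y : glueX x y ->
  glueX ((x.1.1, ~~ x.1.2), x.2) ((y.1.1, ~~ y.1.2), y.2).
Proof.
elim=> [_ _ [[d b] z hz|[d b] z hz]|?|? ? _|? ? ? _ + _] /=.
- by rewrite double_faceE /= -double_faceE; exact: glued_turn.
- by rewrite double_edgeE /= -double_edgeE -/(cross 10 z); exact: glued_cross.
- exact: glued_refl.
- exact: glued_sym.
- exact: glued_trans.
Qed.

Let fold (x : (D * bool) * (R * R)) : Y := tchart (h x.1.1) (up x.2).
Let swap (x : (D * bool) * (R * R)) : X := chartX (x.1.1, ~~ x.1.2) x.2.

Definition covering : X -> Y := descend fold.
Definition deck : X -> X := descend swap.

Let fold_glued d z e w : polygon 5 10 z -> polygon 5 10 w ->
  glueX (d, z) (e, w) -> fold (d, z) = fold (e, w).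
Proof.
move=> hz hw /glued_down g'; apply/tchart_glue => //; exact/polygon_rescale.
Qed.

Let swap_glued d z e w : polygon 5 10 z -> polygon 5 10 w ->
  glueX (d, z) (e, w) -> swap (d, z) = swap (e, w).
Proof. by move=> hz hw /glued_flip g'; apply/chart_eq. Qed.

Lemma covering_chart d b z : polygon 5 10 z ->
  covering (chartX (d, b) z) = tchart (h d) (up z).
Proof. by move=> hz; rewrite /covering descend_chart. Qed.

Lemma deck_chart d b z : polygon 5 10 z -> deck (chartX (d, b) z) = chartX (d, ~~ b) z.
Proof. by move=> hz; rewrite /deck descend_chart. Qed.

Lemma surface_chart (x : X) : exists d b z, polygon 5 10 z /\ x = chartX (d, b) z.
Proof. by have [[d b] [z hz <-]] := chart_surj (isT : (4 < 10)%N) x; exists d, b, z. Qed.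

Lemma covering_continuous : continuous covering.
Proof.
apply: descend_continuous => // -[d b]; apply/subspace_continuousP => z hz A /= nA.
have hz' : polygon 5 5 (up z) by apply/polygon_rescale.
have := (subspace_continuousP _ _).1 (@tchart_cont _ _ _ _ T (h d)) (up z) hz' A nA.
rewrite /nbhs /= /within /= => /(rescale_continuous (q:=10) (q':=5)).
by rewrite /nbhs /=; apply: filterS => w hA hw; apply/hA/polygon_rescale.
Qed.

Lemma deck_continuous : continuous deck.
Proof.
apply: descend_continuous => // -[d b].
exact: (@chart_continuous R 10 _ double_face double_edge (d, ~~ b)).
Qed.

Lemma deckK : involutive deck.
Proof.
move=> x; have [d [b [z [hz ->]]]] := surface_chart x.
by rewrite !deck_chart // negbK.
Qed.

Lemma covering_surj y : exists x, covering x = y.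
Proof.
have [d [z hz <-]] := tchart_surj T y; have hz' : polygon 5 10 (down z) by apply/polygon_rescale.
by exists (chartX (g d, true) (down z)); rewrite covering_chart // downK gK.
Qed.

Lemma covering_fibre x x' : covering x = covering x' <-> x' = x \/ x' = deck x.
Proof.
have [d [b [z [hz ->]]]] := surface_chart x.
have [d' [b' [z' [hz' ->]]]] := surface_chart x'.
rewrite !covering_chart // deck_chart //; split; last first.
  have e c : chartX (d', b') z' = chartX (d, c) z -> tchart (h d) (up z) = tchart (h d') (up z').
    by move=> h'; rewrite -(covering_chart d c hz) -h' covering_chart.
  by case=> /e.
move/tchart_glue => gl; have /glued_up[c] : glueT (h d, up z) (h d', up z').
  by apply: gl; apply/polygon_rescale.
rewrite /= !hK !upK => gl'.
have [cb|cb] := eqVneq (b (+) c) b'; [left|right]; apply/chart_eq => //; apply: glued_sym.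
  by rewrite -cb; exact: gl'.
have -> : b' = ~~ b (+) c by case: (b) (b') (c) cb => -[] [].
exact: gl'.
Qed.

(** The two sheets share no point inside a tile or a side, by the separating
    functions, and are joined at the corners by five crossings. *)
Lemma deck_fixed x : deck x = x <-> vertices T (covering x).
Proof.
have polygon_c0 : polygon 5 10 c0.
  by case: (base_side_corner0 (circumradius_gt0 R (isT : (4 < 10)%N))).
split; last first.
  case=> e _ /esym; rewrite -(@rescale_corner0 R 10 5 isT) -[e]gK.
  rewrite -(covering_chart (g e) true) // => /covering_fibre ex.
  have fixed c : deck (chartX (g e, c) c0) = chartX (g e, c) c0.
    rewrite deck_chart //; apply/chart_eq => //.
    by apply: glued_node_orbit => //; exact: double_node_orbit.
  case: ex => [<-|ex]; first exact: fixed.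
  by rewrite -[x]deckK -ex !fixed.
have [d [b [z [hz ->]]]] := surface_chart x.
have [[e c] [w [gl sw]]] := settle (isT : (4 < 10)%N) double_face double_edge (d, b) hz.
have hw : polygon 5 10 w by exact: (glued_polygon gl).1 hz.
have -> : chartX (d, b) z = chartX (e, c) w by apply/chart_eq.
rewrite deck_chart // covering_chart // => /chart_eq => /(_ hw hw) /glued_sym gl'.
have ne : (~~ c == c) = false by case: (c).
have agr := glued_agree gl'; case: sw => [iw|mw|->].
- have [k] := agree_inside double_face5 double_face_free iw agr.
  by rewrite iter_double_face => -[_ /eqP]; rewrite ne.
- have [[/eqP]|] := agree_mid_side double_edgeK double_face5 mw mw agr; first by rewrite ne.
  by rewrite double_edgeE => -[/esym/eqP]; rewrite (negbTE (edge_neq e)).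
- by exists (h e) => //; rewrite rescale_corner0.
Qed.

Lemma covering_branched : double_cover_branched_over covering (vertices T).
Proof.
apply: (involution_double_cover (s := deck)).
- exact: surface_compact.
- apply: surface_hausdorff => //.
  + exact: double_edgeK.
  + exact: double_edge_neq.
  + exact: double_face5.
  + exact: double_face_free.
- exact: thausdorff T.
- exact: covering_continuous.
- exact: deck_continuous.
- exact: deckK.
- exact: covering_surj.
- exact: covering_fibre.
- exact: deck_fixed.
Qed.
End Cover.
End Double.

(** * The tiling of genus thirteen *)

Section Gamma.
Context (R : realType).
Local Open Scope group_scope.

Local Notation gface := (double_face ico_face).
Local Notation gedge := (double_edge ico_edge).
Local Notation gnode := (gedge * gface)%g.
Local Notation gdart := (icodart * bool)%type.
Local Notation Gamma := (surface R 10 gface gedge).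

Lemma gamma_connected : [transitive <<[set gface; gedge]%SET>>, on [set: gdart]%SET | 'P].
Proof.
have [w0 w0E] := ico_base; apply/imsetP; exists (w0, true); first by rewrite inE.
apply/esym/setP => -[w b]; rewrite inE; move: b.
have stepf x : x \in orbit 'P <<[set gface; gedge]%SET>> (w0, true) ->
    gface x \in orbit 'P <<[set gface; gedge]%SET>> (w0, true).
  case/orbitP => g gG <-; apply/orbitP; exists (g * gface).
    by apply: groupM => //; apply: mem_gen; rewrite !inE eqxx.
  by rewrite /= /aperm permM.
have stepe x : x \in orbit 'P <<[set gface; gedge]%SET>> (w0, true) ->
    gedge x \in orbit 'P <<[set gface; gedge]%SET>> (w0, true).
  case/orbitP => g gG <-; apply/orbitP; exists (g * gedge).
    by apply: groupM => //; apply: mem_gen; rewrite !inE eqxx orbT.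
  by rewrite /= /aperm permM.
have stepn n x : x \in orbit 'P <<[set gface; gedge]%SET>> (w0, true) ->
    iter n gnode x \in orbit 'P <<[set gface; gedge]%SET>> (w0, true).
  by move=> hx; elim: n => //= n IH; rewrite permM; apply/stepf/stepe.
apply: (ico_ind w0E (P := fun w => forall b, (w, b) \in orbit 'P _ (w0, true))).
- have h0 : (w0, true) \in orbit 'P <<[set gface; gedge]%SET>> (w0, true) := orbit_refl _ _ _.
  by case=> //; have := stepn 5%N _ h0; rewrite iter_double_node ico_node5.
- by move=> w' IH b; rewrite -double_faceE; apply: stepf.
- by move=> w' IH b; rewrite -[b]negbK -double_edgeE; apply: stepe.
Qed.

Lemma gamma_edgeK x : gedge (gedge x) = x.
Proof. exact: double_edgeK ico_edgeK x. Qed.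

Lemma gamma_edge_neq x : gedge x != x.
Proof. exact: double_edge_neq ico_edge_neq x. Qed.

Lemma gamma_face5 x : iter 5 gface x = x.
Proof. exact: double_face5 ico_face5 x. Qed.

Lemma gamma_face_free x k : (k < 5)%N -> iter k gface x = x -> k = 0%N.
Proof. exact: double_face_free ico_face_free x k. Qed.

Lemma gamma_face_deg x : #|porbit gface x| = 5%N.
Proof. by apply: card_porbit_free => //; [exact: gamma_face5 | exact: gamma_face_free]. Qed.

Lemma gamma_edge_deg x : #|porbit gedge x| = 2%N.
Proof.
apply: card_porbit_free => //; first exact: gamma_edgeK.
by case=> [|[|k]] //= _ /eqP; rewrite (negbTE (gamma_edge_neq x)).
Qed.

(** The base dart comes back after a multiple of five crossings, the sheet after an
    even number. *)
Lemma gamma_node_deg x : #|porbit gnode x| = 10%N.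
Proof.
case: x => w b; apply: card_porbit_free => //.
  by rewrite iter_double_node (iterD 5 5) !ico_node5.
move=> k k10; rewrite iter_double_node => -[kw kb].
have k5 : (k %% 5 = 0)%N.
  by apply: (@ico_node_free w); rewrite ?ltn_mod // -(iter_mod5 ico_node5).
have {}kb : ~~ odd k by case: (odd k) (b) kb => -[].
have : all (fun k => (k %% 5 == 0) && ~~ odd k ==> (k == 0))%N (iota 0 10) by [].
by move/iota_all => /(_ k k10); rewrite k5 kb => /eqP.
Qed.

Lemma gamma_corner d e : e \in porbit gface d -> e \in porbit gnode d -> e = d.
Proof.
case: d => w b /porbitP[i ->] /porbitP[j]; rewrite !permX iter_double_face iter_double_node.
by case=> /ico_corner ->.
Qed.

Lemma gamma_node_mem w b c m : (iter m (ico_edge * ico_face) w, c) \in porbit gnode (w, b).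
Proof.
have h : iter m gnode (w, b) \in porbit gnode (w, b) by rewrite -permX mem_porbit.
rewrite -eq_porbit_mem in h; rewrite -(eqP h) iter_double_node.
exact: double_node_orbit ico_node5 _ _ _.
Qed.

Lemma gamma_side d x y : gedge d \notin porbit gface d ->
  x \in porbit gface d -> y \in porbit gface (gedge d) -> y \in porbit gnode x ->
  x \in porbit gnode d \/ x \in porbit gnode (gface d).
Proof.
case: d => w b _ /porbitP[i ->] /porbitP[j ->] /porbitP[k].
rewrite !permX double_edgeE !iter_double_face iter_double_node double_faceE.
case=> /esym /ico_side[m [->|->]] _; [left|right]; exact: gamma_node_mem.
Qed.

Definition gamma_tiling : tiling R 5 10 Gamma :=
  Tiling (isT : (4 < (5 - 2) * (10 - 2))%N) gamma_edgeK gamma_edge_neq gamma_connected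
    gamma_face_deg gamma_node_deg gamma_corner gamma_side
    (surface_hausdorff (isT : (4 < 10)%N) gamma_edgeK gamma_edge_neq gamma_face5 gamma_face_free)
    (@chart_continuous R 10 _ gface gedge)
    (@chart_surj R 10 _ gface gedge isT)
    (@chart_eq R 10 _ gface gedge).

Lemma card_gdart : #|{: gdart}| = 120%N.
Proof. by rewrite card_prod card_ico card_bool. Qed.

Lemma gamma_num_tiles : num_tiles gamma_tiling = 24%N.
Proof.
apply/eqP; rewrite -(eqn_pmul2r (isT : (0 < 5)%N)).
by rewrite (card_porbits gamma_face_deg) card_gdart.
Qed.

Lemma gamma_num_edges : num_edges gamma_tiling = 60%N.
Proof.
apply/eqP; rewrite -(eqn_pmul2r (isT : (0 < 2)%N)).
by rewrite (card_porbits gamma_edge_deg) card_gdart.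
Qed.

Lemma gamma_num_vertices : num_vertices gamma_tiling = 12%N.
Proof.
apply/eqP; rewrite -(eqn_pmul2r (isT : (0 < 10)%N)).
by rewrite (card_porbits gamma_node_deg) card_gdart.
Qed.

(** A reflection of the base map lifts in two ways, one of them exchanging the
    sheets. *)
Lemma gamma_reflection x y : exists2 m : {perm gdart}, m x = y &
  gface ^ m = gface^-1 /\ gedge ^ m = gedge.
Proof.
case: x y => [w b] [w' b']; have [m [mw me mf]] := ico_reflection w w'.
have inj : injective (fun u : gdart => (m u.1, u.2 (+) (b (+) b'))).
  by move=> [u c] [u' c'] [/perm_inj-> /addIb->].
have mE u c : perm inj (u, c) = (m u, c (+) (b (+) b')) by rewrite permE.
exists (perm inj); first by rewrite mE mw addbA addbb.
apply/reversalP; split=> -[u c].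
  by rewrite double_faceE !mE double_faceE mf.
by rewrite double_edgeE !mE double_edgeE me addNb.
Qed.

Lemma gamma_regular : regular gamma_tiling.
Proof.
move=> d; have [cm cmd cmR] := gamma_reflection d d.
have [cv cvd cvR] := gamma_reflection d ((gface^-1)%g d).
have [mv mvd mvR] := gamma_reflection d (gedge d).
by exists cm, cv, mv.
Qed.

End Gamma.

Section RegularTilings.
Context (R : realType) (p q : nat) (X : topologicalType) (t : tiling R p q X).
Local Open Scope group_scope.

Lemma regular_rotations (d e : tdart t) : regular t ->
  exists2 h, h \in rotations t & h d = e.
Proof.
move=> /(_ d)[cm [cv [mv [[cmR cmd] [cvR cvd] [mvR mvd]]]]].
have [sR sd] := turn_faceP cmR cvR cmd cvd; have [rR rd] := turn_edgeP cmR mvR cmd mvd.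
by apply: (rotations_transitive (@ttrans _ _ _ _ t)
  (A := 'C([set tface t; tedge t]%SET)%G) sR rR _ sd rd).
Qed.

Lemma edge_deg (d : tdart t) : #|porbit (tedge t) d| = 2%N.
Proof.
apply: card_porbit_free => //; first exact: tedgeK.
by case=> [|[|k]] //= _ /eqP; rewrite (negbTE (tedge_neq _)).
Qed.

Lemma von_dyck_group (d : tdart t) cm cv mv : (2 < p)%N ->
  triangle_reflections d cm cv mv ->
  [/\ #|triangle_group cm cv mv : von_dyck cm cv mv| = 2%N,
      #|von_dyck cm cv mv| = #|tdart t| &
      exists r s : {perm tdart t},
        [/\ half_turn d r /\ face_rotation d s,
            von_dyck cm cv mv = <<[set r; s]%SET>>,
            #[r] = 2%N, #[s] = p & #[s^-1 * r] = q]].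
Proof.
move=> p3 [[cmR cmd] [cvR cvd] [mvR mvd]].
have conn := @ttrans _ _ _ _ t.
have vd : von_dyck cm cv mv = 'C([set tface t; tedge t]%SET).
  exact: (triangle_rotations conn cmR cvR mvR cmd cvd mvd).
have face2 : tface t (tface t d) != d.
  have := iter_fixed_dvd (tface t) 2 d; rewrite tface_deg /= => ->.
  by apply: contraL p3 => /dvdn_leq; rewrite -leqNgt; apply.
rewrite vd; split.
- exact: (index_rotations conn cmR cvR mvR cmd cvd mvd face2).
- exact: (card_rotation_group conn cmR cvR mvR cmd cvd mvd).
exists (turn_edge cm mv), (turn_face cm cv); split.
- by split; [exact: turn_edgeP | exact: turn_faceP].
- by rewrite (rotations_gen conn cmR cvR mvR cmd cvd mvd).
- by rewrite (order_turn_edge conn cmR mvR cmd mvd) edge_deg.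
- by rewrite (order_turn_face conn cmR cvR cmd cvd) tface_deg.
- by rewrite (order_turn_node conn cmR cvR mvR cmd cvd mvd (@tedgeK _ _ _ _ t)) tnode_deg.
Qed.
End RegularTilings.

Theorem proposition3 (R : realType) :
  exists (Gamma : topologicalType) (t : tiling R 5 10 Gamma),
    [/\ has_genus t 13,
        num_tiles t = 24%N,
        forall T : tiling R 5 5 (bring_surface R), bring_tessellation T ->
          exists f : Gamma -> bring_surface R,
            double_cover_branched_over f (vertices T),
        regular t &
        forall (d : tdart t) (cm cv mv : {perm tdart t}),
          triangle_reflections d cm cv mv ->
          [/\ #|triangle_group cm cv mv : von_dyck cm cv mv|%g = 2%N,
              #|von_dyck cm cv mv| = 120%N &
              exists r s : {perm tdart t},
                [/\ half_turn d r /\ face_rotation d s,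
                    von_dyck cm cv mv = <<[set r; s]%SET>>%g,
                    #[r]%g = 2%N, #[s]%g = 5%N & #[s^-1 * r]%g = 10%N]]].
Proof.
exists (surface R 10 (double_face ico_face) (double_edge ico_edge)), (gamma_tiling R).
split.
- by rewrite /has_genus gamma_num_vertices gamma_num_edges gamma_num_tiles.
- exact: gamma_num_tiles.
- move=> T [regT tilesT _ _].
  have cardT : #|tdart T| = 60%N 
    by have := card_porbits (tface_deg (t := T)); rewrite -/(num_tiles T) tilesT.
  have [h [g [hK gK hf he]]] := ico_unique (ttrans T)
    (fun d e => regular_rotations d e regT) cardT (@tedgeK _ _ _ _ T) (@tedge_neq _ _ _ _ T)
    (@tface_deg _ _ _ _ T) (@tnode_deg _ _ _ _ T).
  exists (@covering icodart ico_face ico_edge R _ T h).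
  exact: (covering_branched ico_edgeK ico_edge_neq ico_face5 ico_node5 ico_face_free hK gK hf he).
- exact: gamma_regular.
- move=> d cm cv mv refl; have [h1 h2 h3] := von_dyck_group (isT : (2 < 5)%N) refl.
  by split; rewrite // h2 card_gdart.
Qed.
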